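(* For partitions $\lambda,\mu$ with $\mu\subseteq\lambda$, \[ \omega\big(G_{\lambda/\mu}(\mathbf x;\boldsymbol\alpha,\boldsymbol\beta)\big)=G_{\lambda'/\mu'}(\mathbf x;-\boldsymbol\beta,-\boldsymbol\alpha). \]
   Context: $\lambda',\mu'$ are transposes. A marked multiset-valued tableau of shape $\lambda/\mu$ is a filling $T$ of each cell $(i,j)$ with a nonempty multiset $\{a_1\le\dots\le a_k\}$ of positive integers, in which each $a_t$ with $t\ge2$ and $a_{t-1}<a_t$ may be marked, such that $\max T(i,j)\le\min T(i,j+1)$ and $\max T(i,j)<\min T(i+1,j)$ whenever the cells lie in the shape; its weight is $\mathrm{wt}(T)=\prod_{(i,j)}\mathbf x^{T(i,j)}\alpha_j^{u(T(i,j))-1}(-\beta_i)^{m(T(i,j))}$ ($\mathbf x^{T(i,j)}$ the product of $x_k$ over all elements with multiplicity; $u,m$ the numbers of unmarked and marked elements). $G_{\lambda/\mu}(\mathbf x;\boldsymbol\alpha,\boldsymbol\beta)$ is the sum of $\mathrm{wt}(T)$ over all such tableaux; it is a symmetric formal power series in $\mathbf x$ with coefficients in $\mathbb Z[\boldsymbol\alpha,\boldsymbol\beta]$, each homogeneous $\mathbf x$-component being a symmetric function. $G_{\lambda'/\mu'}(\mathbf x;-\boldsymbol\beta,-\boldsymbol\alpha)$ is obtained by substituting $\alpha_i\mapsto-\beta_i$, $\beta_i\mapsto-\alpha_i$. $\omega$ is the involution of symmetric functions with $\omega(h_n)=e_n$, extended linearly over $\mathbb Z[\boldsymbol\alpha,\boldsymbol\beta]$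 and applied to each homogeneous component. *)

(* Defs.v *)
From Stdlib Require Import ClassicalEpsilon.
From mathcomp Require Import all_boot all_order all_algebra.
From mathcomp Require Import finmap monalg.

Set Implicit Arguments.
Unset Strict Implicit.
Unset Printing Implicit Defensive.

Import GRing.Theory.
Local Open Scope ring_scope.

(* All indices start at 0: the letter k stands for the positive integer k+1,   *)
(* and x k, alpha j, beta i are the x_(k+1), alpha_(j+1), beta_(i+1) of the    *)
(* usual conventions; likewise for the rows and columns of a Young diagram.    *)

Definition xmon := {cmonom nat}.

(* Formal power series in x_0, x_1, ... over R, as coefficient functions.      *)
Definition fps (R : Type) := xmon -> R.

Section SymmetricFunctions.
Variable R : comNzRingType.
Implicit Types F H : fps R.

Definition fps_add F H : fps R := fun m => F m + H m.
Definition fps_scale (c : R) F : fps R := fun m => c * F m.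

(* Every divisor of m is the monomial of an exponent function on the support   *)
(* of m bounded by the degree of m.                                            *)
Definition expfun (m : xmon) := {ffun finsupp m -> 'I_(mdeg m).+1}.
Definition expmon (m : xmon) (d : expfun m) : xmon :=
  [cmonom (d k : nat) | k : finsupp m]%M.

Definition fps_mul F H : fps R := fun m =>
  \sum_(d : expfun m * expfun m | mmul (expmon d.1) (expmon d.2) == m)
     F (expmon d.1) * H (expmon d.2).

Definition homog (d : nat) F : fps R := fun m => if mdeg m == d then F m else 0.

Definition h_series (n : nat) : fps R := fun m => (mdeg m == n)%:R.
Definition e_series (n : nat) : fps R := fun m =>
  ((mdeg m == n) && [forall k : finsupp m, m (val k) <= 1]%N)%:R.

(* The graph of omega on the R-algebra of symmetric functions (of bounded      *)
(* degree): since the h_n are algebraically independent generators, it is the  *)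
(* subalgebra generated by the pairs (h_n, e_n); the unit is (h_0, e_0).       *)
Inductive omega_graph : fps R -> fps R -> Prop :=
| omega_graph_h n : omega_graph (h_series n) (e_series n)
| omega_graph_add F F' H H' : omega_graph F F' -> omega_graph H H' ->
    omega_graph (fps_add F H) (fps_add F' H')
| omega_graph_scale c F F' : omega_graph F F' ->
    omega_graph (fps_scale c F) (fps_scale c F')
| omega_graph_mul F F' H H' : omega_graph F F' -> omega_graph H H' ->
    omega_graph (fps_mul F H) (fps_mul F' H').

Definition omega_bounded F : fps R :=
  epsilon (inhabits (fun _ => 0)) (omega_graph F).

(* omega preserves degrees, so the coefficient of m in omega F comes from the  *)
(* homogeneous component of F of degree mdeg m.                                *)
Definition omega F : fps R := fun m => omega_bounded (homog (mdeg m) F) m.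

End SymmetricFunctions.

Definition is_partition (la : seq nat) : bool :=
  sorted geq la && (0%N \notin la).

Definition partition_sub (mu la : seq nat) : Prop :=
  forall i, (nth 0%N mu i <= nth 0%N la i)%N.

Definition transpose (la : seq nat) : seq nat :=
  [seq count (fun p => j < p)%N la | j <- iota 0 (head 0%N la)].

Section Tableaux.
Variables la mu : seq nat.

Definition in_skew (i j : nat) : bool := (nth 0 mu i <= j < nth 0 la i)%N.

Definition skew_cell :=
  {c : 'I_(size la) * 'I_(head 0%N la) | in_skew c.1 c.2}.

Definition cell_row (c : skew_cell) : nat := (val c).1.
Definition cell_col (c : skew_cell) : nat := (val c).2.

(* A marked multiset is listed in weakly increasing order as pairs             *)
(* (letter, is it marked).                                                     *)
Definition mark_rel (p q : nat * bool) : bool :=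
  (p.1 <= q.1)%N && (q.2 ==> (p.1 < q.1)%N).

Definition is_marked_multiset (s : seq (nat * bool)) : bool :=
  if s is p :: s' then ~~ p.2 && path mark_rel p s' else false.

Definition min_letter (s : seq (nat * bool)) : nat := (head (0%N, false) s).1.
Definition max_letter (s : seq (nat * bool)) : nat := (last (0%N, false) s).1.

Definition is_tableau (T : skew_cell -> seq (nat * bool)) : bool :=
  [&& [forall c, is_marked_multiset (T c)],
      [forall c, forall c',
         (cell_row c' == cell_row c) && (cell_col c' == (cell_col c).+1) ==>
         (max_letter (T c) <= min_letter (T c'))%N] &
      [forall c, forall c',
         (cell_row c' == (cell_row c).+1) && (cell_col c' == cell_col c) ==>
         (max_letter (T c) < min_letter (T c'))%N]].

Definition xweight (T : skew_cell -> seq (nat * bool)) : xmon :=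
  \big[mmul/mone]_(c : skew_cell) \big[mmul/mone]_(p <- T c) ucm p.1.

Definition unmarked (s : seq (nat * bool)) : nat := count (fun p => ~~ p.2) s.
Definition marked (s : seq (nat * bool)) : nat := count (fun p => p.2) s.

Definition cweight (R : comNzRingType) (alpha beta : nat -> R)
    (T : skew_cell -> seq (nat * bool)) : R :=
  \prod_(c : skew_cell)
     (alpha (cell_col c) ^+ (unmarked (T c)).-1 *
      (- beta (cell_row c)) ^+ marked (T c)).

(* The fillings with letters in the support of m and at most deg m letters in  *)
(* each cell: every tableau with xweight m is obtained exactly once from them. *)
Definition bounded_filling (m : xmon) :=
  {ffun skew_cell -> {bseq (mdeg m) of (finsupp m * bool)%type}}.

Definition filling_of (m : xmon) (B : bounded_filling m) :
    skew_cell -> seq (nat * bool) :=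
  fun c => [seq (val p.1, p.2) | p <- B c].

Definition Groth (R : comNzRingType) (alpha beta : nat -> R) : fps R := fun m =>
  \sum_(B : bounded_filling m |
          is_tableau (filling_of B) && (xweight (filling_of B) == m))
     cweight alpha beta (filling_of B).

End Tableaux.

(* The polynomial ring Z[alpha, beta] in two countable families of variables.  *)
Definition Zab : comNzRingType := {malg int[{cmonom (nat + nat)%type}]}.
Definition alpha (j : nat) : Zab := << ucm (inl j) >>.
Definition beta (i : nat) : Zab := << ucm (inr i) >>.

(* Main.v *)
(* For fixed [la, mu], insert the letters of a tableau one after the other and
   record the set of cells filled so far.  The coefficient of a monomial in
   [Groth la mu] is then a matrix coefficient of a product of operators [U_n]
   ([n] the exponent of the letter), with [U(x) = sum_n U_n x^n] an explicit
   product over the cells; reading the same cells with rows and columns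
   exchanged gives operators [U'_n] for the transposed shape, and a sign-reversing
   toggle of one cell proves [U(-x) U'(x) = 1].  The pairs ([h_lambda], [e_lambda])
   have such a presentation too, and the relation [U(-x) U'(x) = 1] expresses the
   coefficients of either member of a pair through those of the other; this makes
   omega well defined.  It remains to see that [Groth] is symmetric, that is, that
   the [U_n] commute: the kernel of [U(x) U(y)] is a product over rows of geometric
   sums that have a closed form symmetric in [x] and [y]. *)

From Stdlib Require Import ClassicalEpsilon.
From HB Require Import structures.
Require Import Defs.
From mathcomp Require Import all_boot all_order all_algebra.
From mathcomp Require Import finmap monalg boolp ring zify.

Set Implicit Arguments.
Unset Strict Implicit.
Unset Printing Implicit Defensive.

Import GRing.Theory.
Local Open Scope ring_scope.

(** * Monomials as words of exponents *)

(** [omega_bounded] picks an image by [epsilon], so the graph must be shown inhabited, and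
    single-valued, at each homogeneous component of [Groth]. Symmetry serves the first point, and is
    applied to the transposed series: its component of degree d is a polynomial in the e_n, hence
    the image of some H. As the second member of a pair determines the first, H has to be the
    component of [Groth] itself.

    The toggle rests on an asymmetry of one insertion: a cell is closed by a right neighbour filled
    before the letter, but by a lower neighbour filled before it or by it. In a step of U followed
    by a step of U', where rows and columns are exchanged, both tests then look at the same sets.
    The cell weights x/(1 - a x) and (1 + b x)/(1 - a x) fit this: replacing x by -x in the second
    gives the inverse of the same expression with a and b exchanged.

    The closed form of the row sums carries a factor y - x, which cannot be cancelled over an
    arbitrary ring; this is why the symmetry in x and y needs an induction of its own. *)

Definition mon (s : seq nat) : xmon :=
  [cmonom nth 0%N s i | i in [fset k | k in iota 0 (size s)]]%M.

Lemma monE s k : mon s k = nth 0%N s k.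
Proof.
rewrite cmE fsfun_fun inE /= mem_iota add0n.
by case: ltnP => // h; rewrite nth_default.
Qed.

Lemma mon_mkseq (m : xmon) N : (forall k, (N <= k)%N -> m k = 0%N) ->
  mon (mkseq m N) = m.
Proof.
move=> h; apply/eqP/cmP => k; rewrite monE.
by case: (ltnP k N) => hk; [rewrite nth_mkseq | rewrite nth_default ?size_mkseq // h].
Qed.

Lemma xmon_bound (m : xmon) : exists N, forall k, (N <= k)%N -> m k = 0%N.
Proof.
exists (\max_(k <- finsupp m) k.+1)%N => k hk.
apply/eqP; rewrite cmE_eq0; apply/negP => km.
have := @leq_bigmax_seq _ (enum_fset (finsupp m)) xpredT (fun k => k.+1) k km isT.
by rewrite /= ltnNge hk.
Qed.

Lemma monP (m : xmon) : exists s, m = mon s.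
Proof. by have [N h] := xmon_bound m; exists (mkseq m N); rewrite mon_mkseq. Qed.

Lemma mon_cat0 s n : mon (s ++ nseq n 0%N) = mon s.
Proof.
apply/eqP/cmP => k; rewrite !monE nth_cat nth_nseq.
by case: ltnP => // h2; rewrite nth_default // if_same.
Qed.

Lemma mdegEn (m : xmon) N : (forall k, (N <= k)%N -> m k = 0%N) ->
  mdeg m = (\sum_(k < N) m k)%N.
Proof.
move=> h; rewrite (@mdegEw _ _ [fset k | k in iota 0 N]%fset); last first.
  apply/fsubsetP => k; rewrite -cmE_neq0 inE /= mem_iota add0n /=.
  by apply: contraNT; rewrite -leqNgt => /h ->.
rewrite -(big_mkord xpredT (fun k => m k)) /index_iota subn0.
apply: perm_big; apply: uniq_perm; rewrite ?fset_uniq ?iota_uniq //.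
by move=> k; rewrite inE.
Qed.

Lemma mdeg_mon s : mdeg (mon s) = sumn s.
Proof.
rewrite (@mdegEn _ (size s)); last by move=> k h; rewrite monE nth_default.
rewrite sumnE (big_nth 0%N) big_mkord; apply: eq_bigr => i _; exact: monE.
Qed.

(** * Products of series on exponent words *)

Section Conv.
Variable R : comNzRingType.
Implicit Types f g h : seq nat -> R.

(** Consumes one letter at a time, so that inductions on it follow the recursion of [run]. *)
Fixpoint conv f g (s : seq nat) : R :=
  if s is n :: s' then
    \sum_(i < n.+1) conv (fun t => f ((i : nat) :: t)) (fun t => g ((n - i)%N :: t)) s'
  else f [::] * g [::].
End Conv.

Section ConvTheory.
Variable R : comNzRingType.
Implicit Types f g h : seq nat -> R.

Lemma eq_conv f f' g g' s :
  (forall t, size t = size s -> f t = f' t) ->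
  (forall t, size t = size s -> g t = g' t) -> conv f g s = conv f' g' s.
Proof.
elim: s f f' g g' => [|n s IH] f f' g g' hf hg /=; first by rewrite hf ?hg.
by apply: eq_bigr => i _; apply: IH => t ht; [apply: hf|apply: hg]; rewrite /= ht.
Qed.

Lemma conv_suml (I : finType) (F : I -> seq nat -> R) g s :
  conv (fun t => \sum_i F i t) g s = \sum_i conv (F i) g s.
Proof.
elim: s F g => [|n s IH] F g /=; first by rewrite mulr_suml.
by rewrite exchange_big; apply: eq_bigr => i _; rewrite IH.
Qed.

Lemma conv_sumr (I : finType) f (G : I -> seq nat -> R) s :
  conv f (fun t => \sum_i G i t) s = \sum_i conv f (G i) s.
Proof.
elim: s f G => [|n s IH] f G /=; first by rewrite mulr_sumr.
by rewrite exchange_big; apply: eq_bigr => i _; rewrite IH.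
Qed.

Lemma convDr f g g' s : conv f (fun t => g t + g' t) s = conv f g s + conv f g' s.
Proof.
elim: s f g g' => [|n s IH] f g g' /=; first by rewrite mulrDr.
by rewrite -big_split; apply: eq_bigr => i _; rewrite IH.
Qed.

Lemma convZr c f g s : conv f (fun t => c * g t) s = c * conv f g s.
Proof.
elim: s f g => [|n s IH] f g /=; first by rewrite mulrCA.
by rewrite mulr_sumr; apply: eq_bigr => i _; rewrite IH.
Qed.

Lemma conv0l f g s : (forall t, f t = 0) -> conv f g s = 0.
Proof.
elim: s f g => [|n s IH] f g h /=; first by rewrite h mul0r.
by rewrite big1 // => i _; apply: IH.
Qed.

Lemma conv0r f g s : (forall t, g t = 0) -> conv f g s = 0.
Proof.
elim: s f g => [|n s IH] f g h /=; first by rewrite h mulr0.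
by rewrite big1 // => i _; apply: IH.
Qed.

(** Both sides run over the triples of sum n; this is the reindexing behind associativity of [conv]
    and of [smul]. *)
Lemma sum_triangle (F : nat -> nat -> nat -> R) n :
  \sum_(i < n.+1) \sum_(j < i.+1) F j (i - j)%N (n - i)%N =
  \sum_(i < n.+1) \sum_(j < (n - i).+1) F i j (n - i - j)%N.
Proof.
transitivity (\sum_(i < n.+1) \sum_(j < n.+1 | (j <= i)%N) F j (i - j)%N (n - i)%N).
  apply: eq_bigr => i _.
  rewrite (big_ord_widen n.+1 (fun j => F j (i - j)%N (n - i)%N)) //.
rewrite (exchange_big_dep xpredT) //=; apply: eq_bigr => j _.
rewrite -(big_mkord (fun i => (j <= i)%N) (fun i => F j (i - j)%N (n - i)%N)).
have hj : (j <= n)%N by rewrite -ltnS.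
rewrite (big_cat_nat (n := j)) //=; last exact: leqW.
rewrite big_nat_cond big1 ?add0r; last by move=> i /andP[/andP[_ h1]]; rewrite leqNgt h1.
rewrite -{1}(add0n (j : nat)) big_addn subSn // big_mkord.
apply: eq_big => [i|i _]; first by rewrite leq_addl.
by rewrite addnK subnDAC subnAC.
Qed.

Lemma conv_assoc f g h s : conv (conv f g) h s = conv f (conv g h) s.
Proof.
elim: s f g h => [|n s IH] f g h /=; first by rewrite mulrA.
under eq_bigr do rewrite conv_suml.
under [RHS]eq_bigr do rewrite conv_sumr.
under eq_bigr do under eq_bigr do rewrite IH.
exact: (sum_triangle (fun a b c => conv (fun t => f (a :: t))
   (conv (fun t => g (b :: t)) (fun t => h (c :: t))) s)).
Qed.

(** Adjacent swaps are what commuting operators provide; they generate all permutations of a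
    word. *)
Definition swap_inv f := forall s1 a b s2,
  f (s1 ++ a :: b :: s2) = f (s1 ++ b :: a :: s2).

Lemma conv_swap f g : swap_inv f -> swap_inv g -> swap_inv (conv f g).
Proof.
move=> hf hg s1; elim: s1 f g hf hg => [|n s1 IH] f g hf hg a b s2 /=.
  rewrite exchange_big; apply: eq_bigr => i _; apply: eq_bigr => j _.
  by apply: eq_conv => t _; [apply: (hf [::])|apply: (hg [::])].
apply: eq_bigr => i _; apply: IH => t1 u v t2; first exact: (hf (_ :: t1)).
exact: (hg (_ :: t1)).
Qed.

Lemma swap_inv_perm f s t : swap_inv f -> perm_eq s t -> f s = f t.
Proof.
move=> hf.
have mv x s1 s2 s3 : f (s1 ++ x :: s2 ++ s3) = f (s1 ++ s2 ++ x :: s3).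
  elim: s2 s1 => [//|y s2 IH] s1 /=.
  by rewrite hf -[s1 ++ y :: _]cat_rcons IH cat_rcons.
have gen p : perm_eq s t -> f (p ++ s) = f (p ++ t).
  elim: s t p => [|x s IH] t p h; first by rewrite (perm_nilP (_ : perm_eq t [::])) // perm_sym.
  have xt : x \in t by rewrite -(perm_mem h) mem_head.
  case/splitPr: xt h => t1 t2 h.
  rewrite -(mv x p t1 t2) -!cat_rcons; apply: IH.
  by rewrite -(perm_cons x); apply: (perm_trans h); rewrite -[x :: t2]cat1s perm_catCA.
exact: (gen [::]).
Qed.

Fixpoint subws (s : seq nat) : seq (seq nat) :=
  if s is n :: s' then [seq i :: t | i <- iota 0 n.+1, t <- subws s'] else [:: [::]].

Definition subw s t : seq nat := [seq (p.1 - p.2)%N | p <- zip s t].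

Lemma convE f g s : conv f g s = \sum_(t <- subws s) f t * g (subw s t).
Proof.
elim: s f g => [|n s IH] f g; first by rewrite /= big_seq1.
rewrite [RHS]big_allpairs_dep [LHS]/=.
rewrite -(big_mkord xpredT (fun i => conv (fun t => f (i :: t)) (fun t => g ((n - i)%N :: t)) s)).
rewrite /index_iota subn0; apply: eq_bigr => i _; exact: IH.
Qed.

Lemma subws_uniq s : uniq (subws s).
Proof.
elim: s => [//|n s IH]; apply: allpairs_uniq => //; first exact: (iota_uniq 0 n.+1).
by move=> [i t] [j u] _ _ /= [-> ->].
Qed.

Lemma mem_subws s t :
  (t \in subws s) = (size t == size s) && all2 leq t s.
Proof.
elim: s t => [|n s IH] [|i t] //.
  by apply/negP => /allpairsP[[]] ? ? [].
rewrite [RHS]/= eqSS; apply/allpairsP/idP => [[[j u] []]|].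
  rewrite mem_iota add0n ltnS IH /=.
  by move=> hj /andP[h1 h2] [-> ->]; rewrite h1 hj.
move=> /andP[h1 /andP[h2 h3]]; exists (i, t).
by rewrite mem_iota add0n ltnS h2 IH h1 h3.
Qed.
End ConvTheory.

(** * Passage from monomials to words *)

Section Bridge.
Variable R : comNzRingType.

Lemma expmon_val (m : xmon) (d : expfun m) (k : finsupp m) : expmon d (val k) = d k.
Proof. by rewrite cmE fsfun_ffun insubT //= => h; congr (nat_of_ord (d _)); apply: val_inj. Qed.

Lemma expmon_out (m : xmon) (d : expfun m) k : k \notin finsupp m -> expmon d k = 0%N.
Proof. by move=> h; rewrite cmE fsfun_ffun insubF //; apply: negbTE. Qed.

Lemma mdeg_ge (m : xmon) k : (m k <= mdeg m)%N.
Proof.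
case: (mdomP m k) => // h.
by rewrite mdegE (big_fsetD1 k) //= leq_addr.
Qed.

Lemma expmon_ex (m m' : xmon) : (forall k, (m' k <= m k)%N) ->
  exists d : expfun m, expmon d = m'.
Proof.
move=> h; exists [ffun k => inord (m' (val k))]; apply/eqP/cmP => k.
case: (boolP (k \in finsupp m)) => hk.
  rewrite -[k]/(val (FSetSub hk)) expmon_val ffunE inordK // ltnS.
  exact: leq_trans (h _) (mdeg_ge _ _).
rewrite expmon_out //; move: (h k); move: hk; rewrite -cmE_eq0 => /eqP ->.
by rewrite leqn0 => /eqP.
Qed.

Lemma expmon_inj (m : xmon) : injective (@expmon m).
Proof.
by move=> d d' h; apply/ffunP => k; apply: val_inj; rewrite /= -!expmon_val h.
Qed.

Lemma fps_mulE (F H : fps R) s :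
  fps_mul F H (mon s) = conv (fun t => F (mon t)) (fun t => H (mon t)) s.
Proof.
rewrite convE /fps_mul.
set E := expfun (mon s).
pose P (d : E * E) := mmul (expmon d.1) (expmon d.2) == mon s.
pose w (d : E * E) := mkseq (expmon d.1) (size s).
have sz t : size t = size s -> subw s t = mkseq (fun i => nth 0 s i - nth 0 t i)%N (size s).
  move=> ht; apply: (@eq_from_nth _ 0%N); rewrite size_map size_zip ht minnn ?size_mkseq //.
  by move=> i hi; rewrite (nth_map (0%N, 0%N)) ?size_zip ?ht ?minnn // nth_zip // nth_mkseq.
have Pk d k : P d -> (expmon d.1 k + expmon d.2 k)%N = nth 0%N s k.
  by move=> /eqP h; rewrite -cmM h monE.
have w1 d : P d -> expmon d.1 = mon (w d).
  move=> h; rewrite mon_mkseq // => k hk; have := Pk d k h.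
  by rewrite nth_default // => /eqP; rewrite addn_eq0 => /andP[/eqP].
have w2 d : P d -> expmon d.2 = mon (subw s (w d)).
  move=> h; rewrite sz ?size_mkseq //; apply/eqP/cmP => k; rewrite monE.
  have e := Pk d k h; case: (ltnP k (size s)) => hk.
    by rewrite nth_mkseq // nth_mkseq // -e addKn.
  rewrite nth_default ?size_mkseq //; move: e; rewrite nth_default //.
  by move/eqP; rewrite addn_eq0 => /andP[_ /eqP].
(* A pair of complementary divisors is determined by its first member, read as a word bounded
   entrywise by s. *)
have pe : perm_eq [seq w d | d <- enum P] (subws s).
  apply: uniq_perm; rewrite ?subws_uniq //.
    rewrite map_inj_in_uniq ?enum_uniq // => -[d1 d2] [d1' d2'].
    rewrite !mem_enum => h h' e; congr pair; apply: expmon_inj.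
      by rewrite (w1 _ h) e -(w1 _ h').
    by rewrite (w2 _ h) e -(w2 _ h').
  move=> t; rewrite mem_subws; apply/mapP/idP => [[d]|/andP[/eqP h1 h2]].
    rewrite mem_enum => h ->; rewrite size_mkseq eqxx /=.
    have hle k : (k < size s)%N -> (nth 0 (w d) k <= nth 0 s k)%N.
      by move=> hk; rewrite nth_mkseq // -(Pk _ k h) leq_addr.
    have: size (w d) = size s by rewrite size_mkseq.
    elim: (s) (w d) hle => [|n u IH] [|i v] // hle [hs] /=.
    by rewrite (hle 0%N) // IH // => k hk; apply: (hle k.+1).
  have hle k : (nth 0 t k <= nth 0 s k)%N.
    elim: (s) (t) k h1 h2 => [|n u IH] [|i v] // [|k] //= [hs] /andP[] // _; exact: IH.
  have [d1 e1] : exists d : E, expmon d = mon t.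
    by apply: expmon_ex => k; rewrite !monE.
  have [d2 e2] : exists d : E, expmon d = mon (subw s t).
    apply: expmon_ex => k; rewrite !monE sz //.
    case: (ltnP k (size s)) => hk; first by rewrite nth_mkseq // leq_subr.
    by rewrite nth_default ?size_mkseq.
  exists (d1, d2).
    rewrite mem_enum; apply/eqP/eqP/cmP => k; rewrite cmM /= e1 e2 !monE sz //.
    case: (ltnP k (size s)) => hk; first by rewrite nth_mkseq // subnKC.
    by rewrite !nth_default ?size_mkseq ?h1.
  rewrite /w /= e1; apply: (@eq_from_nth _ 0%N); rewrite ?size_mkseq // => i hi.
  by rewrite nth_mkseq -?h1 // monE.
rewrite -(perm_big _ pe) big_map big_enum_cond /=.
by apply: eq_big => d; rewrite ?andbT // => h; rewrite (w1 _ h) (w2 _ h).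
Qed.

Lemma fpsP (F H : fps R) : (forall s, F (mon s) = H (mon s)) -> F = H.
Proof. by move=> h; apply: funext => m; have [s ->] := monP m. Qed.

Lemma fps_mulA (F G H : fps R) : fps_mul (fps_mul F G) H = fps_mul F (fps_mul G H).
Proof.
apply: fpsP => s; rewrite !fps_mulE.
transitivity (conv (conv (fun t => F (mon t)) (fun t => G (mon t))) (fun t => H (mon t)) s).
  by apply: eq_conv => t _ //; rewrite fps_mulE.
rewrite conv_assoc; by apply: eq_conv => t _ //; rewrite fps_mulE.
Qed.

Lemma fps_mulDr (F G H : fps R) :
  fps_mul F (fps_add G H) = fps_add (fps_mul F G) (fps_mul F H).
Proof. by apply: fpsP => s; rewrite /fps_add !fps_mulE convDr. Qed.

Lemma fps_mulZr c (F G : fps R) :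
  fps_mul F (fps_scale c G) = fps_scale c (fps_mul F G).
Proof. by apply: fpsP => s; rewrite /fps_scale !fps_mulE convZr. Qed.

Definition hword n (s : seq nat) : R := (sumn s == n)%:R.
Definition eword n (s : seq nat) : R := ((sumn s == n) && all (fun k => k <= 1)%N s)%:R.

Lemma h_seriesE n s : h_series R n (mon s) = hword n s.
Proof. by rewrite /h_series mdeg_mon. Qed.

Lemma e_seriesE n s : e_series R n (mon s) = eword n s.
Proof.
rewrite /e_series mdeg_mon; congr (_ && _)%:R.
apply/forallP/allP => [h k ks|h k].
  rewrite -(nth_index 0%N ks) -monE.
  by case: (mdomP (mon s) (index k s)) => // hk; apply: (h (FSetSub hk)).
rewrite monE; case: (ltnP (val k) (size s)) => hk; last by rewrite nth_default.
exact/h/mem_nth.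
Qed.
End Bridge.

(** * Dual families of operators *)

Section Additive.
Variables (V W : zmodType) (f : V -> W).
Hypothesis fD : {morph f : u v / u + v}.

Lemma morphD0 : f 0 = 0.
Proof. by apply: (addIr (f 0)); rewrite -fD !add0r. Qed.

Lemma morphDN u : f (- u) = - f u.
Proof. by apply: (addIr (f u)); rewrite -fD !addNr morphD0. Qed.

Lemma morphD_sum (I : Type) (r : seq I) (P : pred I) (F : I -> V) :
  f (\sum_(i <- r | P i) F i) = \sum_(i <- r | P i) f (F i).
Proof. exact: (big_morph f fD morphD0). Qed.
End Additive.

Definition sgn (V : zmodType) (n : nat) (v : V) : V := if odd n then - v else v.

Lemma morph_sgn (V W : zmodType) (f : V -> W) n v :
  {morph f : u v / u + v} -> f (sgn n v) = sgn n (f v).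
Proof. by move=> fD; rewrite /sgn; case: ifP => _ //; rewrite morphDN. Qed.

Lemma sgnD (V : zmodType) n : {morph (@sgn V n) : u v / u + v}.
Proof. by move=> u v; rewrite /sgn; case: ifP => _ //; rewrite opprD. Qed.

Lemma sgnS (V : zmodType) n (v : V) : sgn n.+1 v = - sgn n v.
Proof. by rewrite /sgn /=; case: (odd n); rewrite /= ?opprK. Qed.

Lemma sgnK (V : zmodType) n : involutive (@sgn V n).
Proof. by move=> v; rewrite /sgn; case: (odd n); rewrite ?opprK. Qed.

Definition run (V : Type) (U : nat -> V -> V) (s : seq nat) (v : V) : V :=
  foldr U v s.

(* With [U(t) = sum_n U_n t^n], the last condition says [U(-t) U'(t) = 1]. *)
Record dual_ops (V : zmodType) (U U' : nat -> V -> V) : Prop := DualOps {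
  dual_addl : forall n, {morph U n : u v / u + v};
  dual_addr : forall n, {morph U' n : u v / u + v};
  dual_0l : forall v, U 0%N v = v;
  dual_0r : forall v, U' 0%N v = v;
  dual_inv : forall n v, \sum_(i < n.+2) sgn i (U i (U' (n.+1 - i)%N v)) = 0
}.

Section Transfer.
Variables (R : comNzRingType) (V W : zmodType).
Variables (U U' : nat -> V -> V) (phi : V -> R) (v0 : V).
Variables (X X' : nat -> W -> W) (psi : W -> R) (w0 : W).
Hypotheses (dU : dual_ops U U') (dX : dual_ops X X').
Hypotheses (phiD : {morph phi : u v / u + v}) (psiD : {morph psi : u v / u + v}).

Lemma run_add (T : zmodType) (Y : nat -> T -> T) s :
  (forall n, {morph Y n : u v / u + v}) -> {morph run Y s : u v / u + v}.
Proof. by move=> h u v; elim: s => [//|n s IH] /=; rewrite IH h. Qed.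

Lemma run_rcons (T : Type) (Y : nat -> T -> T) s n v :
  run Y (rcons s n) v = run Y s (Y n v).
Proof. by rewrite /run foldr_rcons. Qed.

(** Both systems are rewritten in parallel. In a mixed word, with all U to the left of all U', the
    relation U(-t) U'(t) = 1 replaces the leftmost U'_(n+1) by terms U_(i+1) U'_(n-i), which moves
    degree across the boundary until no U' is left. *)
Lemma transfer_fwd d :
  (forall s, sumn s = d -> phi (run U s v0) = psi (run X s w0)) ->
  forall s, sumn s = d -> phi (run U' s v0) = psi (run X' s w0).
Proof.
move=> h.
(* The summand [size t] makes the removal of a zero exponent count as progress. *)
have gen k : forall t s, (sumn t + size t <= k)%N -> (sumn s + sumn t)%N = d ->
    phi (run U s (run U' t v0)) = psi (run X s (run X' t w0)).
  elim: k => [|k IH] [|n t] s //=; rewrite ?addn0.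
  - by move=> _; apply: h.
  - by rewrite addnS.
  - by move=> _; apply: h.
  case: n => [|n] hk hd.
    rewrite (dual_0r dU) (dual_0r dX); apply: IH => //.
    by move: hk; rewrite add0n addnS ltnS.
  (* Solves [dual_inv] for its term i = 0, where U_0 is the identity. *)
  have ex (T : zmodType) (Y Y' : nat -> T -> T) (dY : dual_ops Y Y') v :
      Y' n.+1 v = - \sum_(i < n.+1) sgn i.+1 (Y i.+1 (Y' (n - i)%N v)).
    have := dual_inv dY n v; rewrite big_ord_recl /= /sgn (dual_0l dY) subn0.
    by move/eqP; rewrite addr_eq0 => /eqP ->; congr (- _); apply: eq_bigr => i _.
  rewrite (ex _ _ _ dU) (ex _ _ _ dX).
  have aU := run_add s (dual_addl dU); have aX := run_add s (dual_addl dX).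
  rewrite (morphDN aU) (morphDN aX) (morphDN phiD) (morphDN psiD); congr (- _).
  rewrite (morphD_sum aU) (morphD_sum aX) (morphD_sum phiD) (morphD_sum psiD).
  apply: eq_bigr => i _; rewrite !(morph_sgn _ _ aU, morph_sgn _ _ aX).
  rewrite (morph_sgn _ _ phiD) (morph_sgn _ _ psiD); congr (sgn _ _).
  have hi : (i <= n)%N by rewrite -ltnS.
  rewrite -!run_rcons; apply: (IH ((n - i)%N :: t)) => /=; last first.
    by rewrite -hd -cats1 sumn_cat /=; lia.
  by lia.
by move=> s hs; apply: (gen _ s [::] (leqnn _)).
Qed.

(** The boundary is crossed in the other direction: the last U, adjacent to the U' block, is
    eliminated, whence the case analysis at the right end of s. *)
Lemma transfer_bwd d :
  (forall s, sumn s = d -> phi (run U' s v0) = psi (run X' s w0)) ->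
  forall s, sumn s = d -> phi (run U s v0) = psi (run X s w0).
Proof.
move=> h.
have gen k : forall s t, (sumn s + size s <= k)%N -> (sumn s + sumn t)%N = d ->
    phi (run U s (run U' t v0)) = psi (run X s (run X' t w0)).
  elim: k => [|k IH] s t; case/lastP: s => [|s n]; rewrite ?size_rcons ?addnS //.
  - by move=> _; apply: h.
  - by move=> _; apply: h.
  rewrite -cats1 sumn_cat /= addn0 ltnS => hk hd.
  rewrite cats1 !run_rcons.
  case: n hk hd => [|n] hk hd.
    rewrite (dual_0l dU) (dual_0l dX); apply: IH; by rewrite ?addn0 in hk hd *.
  (* Solves [dual_inv] for its last term, where U'_0 is the identity. *)
  have ex (T : zmodType) (Y Y' : nat -> T -> T) (dY : dual_ops Y Y') v :
      Y n.+1 v = - sgn n.+1 (\sum_(i < n.+1) sgn i (Y i (Y' (n.+1 - i)%N v))).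
    have := dual_inv dY n v; rewrite big_ord_recr /= subnn (dual_0r dY).
    move/eqP; rewrite addrC addr_eq0 => /eqP e.
    by rewrite -(morphDN (@sgnD T n.+1)) -e sgnK.
  rewrite (ex _ _ _ dU) (ex _ _ _ dX).
  have aU := run_add s (dual_addl dU); have aX := run_add s (dual_addl dX).
  rewrite (morphDN aU) (morphDN aX) (morphDN phiD) (morphDN psiD); congr (- _).
  rewrite !(morph_sgn _ _ aU, morph_sgn _ _ aX).
  rewrite (morph_sgn _ _ phiD) (morph_sgn _ _ psiD); congr (sgn _ _).
  rewrite (morphD_sum aU) (morphD_sum aX) (morphD_sum phiD) (morphD_sum psiD).
  apply: eq_bigr => i _; rewrite !(morph_sgn _ _ aU, morph_sgn _ _ aX).
  rewrite (morph_sgn _ _ phiD) (morph_sgn _ _ psiD); congr (sgn _ _).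
  have hi : (i <= n)%N by rewrite -ltnS.
  rewrite -!run_rcons; apply: (IH _ ((n.+1 - i)%N :: t)); rewrite -cats1 sumn_cat ?size_cat /=; lia.
by move=> s hs; apply: (gen _ s [::] (leqnn _)); rewrite /= addn0.
Qed.
End Transfer.

(* Stands for [G = omega F]: both series are matrix coefficients of words in
   operators [U_n], resp. [U'_n], related like the [h_n] and the [e_n]. *)
Inductive omega_pair (R : comNzRingType) (F G : fps R) : Prop :=
| OmegaPair (V : zmodType) (U U' : nat -> V -> V) (phi : V -> R) (v0 : V)
    of dual_ops U U' & {morph phi : u v / u + v} &
    (forall s, F (mon s) = phi (run U s v0)) &
    (forall s, G (mon s) = phi (run U' s v0)).

(** Uniqueness of the image, degree by degree, even when the two pairs are presented by unrelated
    modules and operators. *)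
Lemma omega_pair_fwd (R : comNzRingType) (F F' G G' : fps R) d :
  omega_pair F G -> omega_pair F' G' ->
  (forall m, mdeg m = d -> F m = F' m) -> forall m, mdeg m = d -> G m = G' m.
Proof.
case=> V U U' phi v0 dU phiD hF hG [W X X' psi w0 dX psiD hF' hG'] h m.
have [s ->] := monP m; rewrite mdeg_mon hG hG'.
apply: (transfer_fwd dU dX) => // t ht.
by rewrite -hF -hF' h ?mdeg_mon.
Qed.

(** Injectivity, which later identifies an unknown preimage with a component of [Groth]. *)
Lemma omega_pair_bwd (R : comNzRingType) (F F' G G' : fps R) d :
  omega_pair F G -> omega_pair F' G' ->
  (forall m, mdeg m = d -> G m = G' m) -> forall m, mdeg m = d -> F m = F' m.
Proof.
case=> V U U' phi v0 dU phiD hF hG [W X X' psi w0 dX psiD hF' hG'] h m.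
have [s ->] := monP m; rewrite mdeg_mon hF hF'.
apply: (transfer_bwd dU dX) => // t ht.
by rewrite -hG -hG' h ?mdeg_mon.
Qed.

(** * Power series *)

(** Serves both as a module, where multiplication by h_n and e_n is encoded, and as a ring of
    generating functions in the exponent of a letter. *)
Definition series (V : Type) := nat -> V.

HB.instance Definition _ (V : Type) := gen_eqMixin (series V).
HB.instance Definition _ (V : Type) := gen_choiceMixin (series V).

Section SeriesZmod.
Variable V : zmodType.
Definition sadd (f g : series V) : series V := fun n => f n + g n.
Definition sopp (f : series V) : series V := fun n => - f n.
Definition szero : series V := fun=> 0.

Lemma saddA : associative sadd.
Proof. by move=> f g h; apply: funext => n; rewrite /sadd addrA. Qed.
Lemma saddC : commutative sadd.
Proof. by move=> f g; apply: funext => n; rewrite /sadd addrC. Qed.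
Lemma sadd0 : left_id szero sadd.
Proof. by move=> f; apply: funext => n; rewrite /sadd add0r. Qed.
Lemma saddN : left_inverse szero sopp sadd.
Proof. by move=> f; apply: funext => n; rewrite /sadd addNr. Qed.

HB.instance Definition _ :=
  GRing.isZmodule.Build (series V) saddA saddC sadd0 saddN.

Lemma seriesD (f g : series V) n : (f + g) n = f n + g n. Proof. by []. Qed.
Lemma seriesN (f : series V) n : (- f) n = - f n. Proof. by []. Qed.
Lemma series0 n : (0 : series V) n = 0. Proof. by []. Qed.
Lemma series_sum (I : Type) (r : seq I) (P : pred I) (F : I -> series V) n :
  (\sum_(i <- r | P i) F i) n = \sum_(i <- r | P i) F i n.
Proof. by apply: (big_morph (fun f : series V => f n)). Qed.
End SeriesZmod.

Section SeriesRing.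
Variable R : comNzRingType.
Definition smul (f g : series R) : series R :=
  fun n => \sum_(i < n.+1) f i * g (n - i)%N.
Definition sone : series R := fun n => (n == 0%N)%:R.

Lemma smulC : commutative smul.
Proof.
move=> f g; apply: funext => n; rewrite /smul (reindex_inj rev_ord_inj) /=.
apply: eq_bigr => i _; rewrite mulrC subSS; congr (g _ * _).
by rewrite subKn // -ltnS.
Qed.

Lemma smulA : associative smul.
Proof.
move=> f g h; apply: funext => n; rewrite /smul.
under eq_bigr do rewrite mulr_sumr.
under [RHS]eq_bigr do rewrite mulr_suml.
rewrite -(sum_triangle (fun a b c => f a * (g b * h c))).
by do 2! [apply: eq_bigr => ? _]; rewrite mulrA.
Qed.

Lemma smul1 : left_id sone smul.
Proof.
move=> f; apply: funext => n; rewrite /smul big_ord_recl mul1r subn0.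
by rewrite big1 ?addr0 // => i _; rewrite mul0r.
Qed.

Lemma smulDl : left_distributive smul (@sadd R).
Proof.
move=> f g h; apply: funext => n; rewrite /smul /sadd -big_split.
by apply: eq_bigr => i _; rewrite mulrDl.
Qed.

Lemma sone_neq0 : sone != 0 :> series R.
Proof.
apply/eqP => /(congr1 (fun f => f 0%N)); rewrite /sone eqxx => /eqP.
by rewrite oner_eq0.
Qed.

HB.instance Definition _ := GRing.Zmodule_isComNzRing.Build (series R)
  smulA smulC smul1 smulDl sone_neq0.

Lemma seriesM (f g : series R) n : (f * g) n = \sum_(i < n.+1) f i * g (n - i)%N.
Proof. by []. Qed.
Lemma series1 n : (1 : series R) n = (n == 0%N)%:R. Proof. by []. Qed.
End SeriesRing.

(** * Every element of the graph of omega is a dual pair *)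

Section Closure.
Variable R : comNzRingType.
Implicit Types F G : fps R.

(** Used to show that an unknown preimage vanishes outside one degree. *)
Lemma omega_pair0 : omega_pair (fun _ => 0 : R) (fun _ => 0).
Proof.
exists R (fun n v => if n is 0 then v else 0) (fun n v => if n is 0 then v else 0)
  (fun=> 0) 0 => //; last by move=> u v; rewrite addr0.
split=> // [[|n] u v|[|n] u v|n v]; rewrite ?addr0 //.
rewrite big1 // => -[[|i] hi] _ //=.
by rewrite /sgn; case: ifP; rewrite ?oppr0.
Qed.

Lemma omega_pair1 : omega_pair (h_series R 0) (e_series R 0).
Proof.
pose U n (v : R) := if n is 0 then v else 0 : R.
have e s : run U s 1 = (sumn s == 0%N)%:R.
  by elim: s => [|[|n] s IH] //=; rewrite IH.
exists R U U id 1 => // [|s|s].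
- split=> // [[|n] u v|[|n] u v|n v]; rewrite /U ?addr0 //.
  rewrite big1 // => -[[|i] hi] _ //=.
  by rewrite /sgn; case: ifP; rewrite ?oppr0.
- by rewrite h_seriesE e.
rewrite e_seriesE e /eword.
by case: natnseq0P => // ->; rewrite all_nseq orbT.
Qed.

Lemma omega_pairD F G F' G' : omega_pair F G -> omega_pair F' G' ->
  omega_pair (fps_add F F') (fps_add G G').
Proof.
case=> V U U' phi v0 dU phiD hF hG [W X X' psi w0 dX psiD hF' hG'].
pose Y n (p : V * W) := (U n p.1, X n p.2).
pose Y' n (p : V * W) := (U' n p.1, X' n p.2).
have e s : run Y s (v0, w0) = (run U s v0, run X s w0).
  by elim: s => [|n s IH] //=; rewrite IH.
have e' s : run Y' s (v0, w0) = (run U' s v0, run X' s w0).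
  by elim: s => [|n s IH] //=; rewrite IH.
exists (V * W)%type Y Y' (fun p => phi p.1 + psi p.2) (v0, w0).
- case: dU dX => d1 d2 d3 d4 d5 [d6 d7 d8 d9 d10].
  split=> [n [? ?] [? ?]|n [? ?] [? ?]|[? ?]|[? ?]|n [v w]]; rewrite /Y /Y' /=.
  + by rewrite d1 d6.
  + by rewrite d2 d7.
  + by rewrite d3 d8.
  + by rewrite d4 d9.
  rewrite [LHS]surjective_pairing; congr pair.
    rewrite -[RHS](d5 n v) (big_morph fst (id1 := 0) (op1 := +%R)) //.
    by apply: eq_bigr => i _; rewrite /sgn; case: ifP.
  rewrite -[RHS](d10 n w) (big_morph snd (id1 := 0) (op1 := +%R)) //.
  by apply: eq_bigr => i _; rewrite /sgn; case: ifP.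
- by move=> [? ?] [? ?] /=; rewrite phiD psiD addrACA.
- by move=> s; rewrite /fps_add hF hF' e.
by move=> s; rewrite /fps_add hG hG' e'.
Qed.

Lemma omega_pairZ c F G : omega_pair F G ->
  omega_pair (fps_scale c F) (fps_scale c G).
Proof.
case=> V U U' phi v0 dU phiD hF hG.
exists V U U' (fun v => c * phi v) v0 => // [u v|s|s].
- by rewrite phiD mulrDr.
- by rewrite /fps_scale hF.
by rewrite /fps_scale hG.
Qed.

Definition shift (V : zmodType) (f : series V) : series V :=
  fun n => if n is n'.+1 then f n' else 0.

Lemma shiftD (V : zmodType) : {morph (@shift V) : u v / u + v}.
Proof. by move=> f g; apply: funext => -[|n]; rewrite !seriesD //= addr0. Qed.

Definition smap (V W : Type) (g : V -> W) (f : series V) : series W :=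
  fun n => g (f n).

(* The coefficients in [t] of [U(t) / (1 - y t)] and [U'(t) (1 + y t)],
   where [y] is the shift of [series V]. *)
Fixpoint geom_op (V : zmodType) (U : nat -> V -> V) n (f : series V) : series V :=
  smap (U n) f + (if n is n'.+1 then shift (geom_op U n' f) else 0).

Definition lin_op (V : zmodType) (U : nat -> V -> V) n (f : series V) : series V :=
  smap (U n) f + (if n is n'.+1 then shift (smap (U n') f) else 0).

Definition sconst (V : zmodType) (v : V) : series V :=
  fun p => if p is 0 then v else 0.

Lemma geom_opE (V : zmodType) (U : nat -> V -> V) n f p :
  geom_op U n f p =
    \sum_(j < n.+1 | (j <= p)%N) U (n - j)%N (f (p - j)%N).
Proof.
elim: n p => [|n IH] p; rewrite [LHS]/= seriesD big_mkcond big_ord_recl /= !subn0.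
  by rewrite big_ord0.
case: p => [|p] /=; first by rewrite big1 ?addr0.
by rewrite IH; congr (_ + _); rewrite [LHS]big_mkcond; apply: eq_bigr => j _.
Qed.

(** The shift y commutes with the operators, so the product is U(-t) (1 + y t)^(-1) (1 + y t) U'(t)
    = U(-t) U'(t) = 1. *)
Lemma geom_lin_dual (V : zmodType) (U U' : nat -> V -> V) :
  dual_ops U U' -> dual_ops (geom_op U) (lin_op U').
Proof.
move=> [aU aU' U0 U'0 inv].
have aG n : {morph geom_op U n : u v / u + v}.
  elim: n => [|n IH] f g; apply: funext => p /=; rewrite /smap !seriesD aU.
    by rewrite !series0 !addr0.
  by rewrite IH shiftD seriesD addrACA.
have aL n : {morph lin_op U' n : u v / u + v}.
  case: n => [|n] f g; apply: funext => p; rewrite /lin_op !seriesD /smap !seriesD aU'.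
    by rewrite !series0 !addr0.
  case: p => [|p]; first by rewrite /shift /= !addr0.
  by rewrite /shift /= aU' addrACA.
split=> // [f|f|n f].
- by apply: funext => p; rewrite /= seriesD series0 addr0 /smap U0.
- by apply: funext => p; rewrite /lin_op seriesD series0 addr0 /smap U'0.
pose G n f := smap (U' n) f.
(* [D] collects the coefficients of U(-t) (1 + y t)^(-1) U'(t), and [D'] those of U(-t) U'(t) = 1.
   Hence [D] is the series of (1 + y t)^(-1), which is the recursion [DS]. *)
pose D n f := \sum_(i < n.+1) sgn i (geom_op U i (G (n - i)%N f)).
pose D' n f := (\sum_(i < n.+1) sgn i (smap (U i) (G (n - i)%N f))).
have D'E k : D' k f = if k is 0 then f else 0.
  case: k => [|k]; apply: funext => p; rewrite /D' series_sum.
    by rewrite big_ord1 /G /smap /sgn /= U0 U'0.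
  rewrite series0 -[RHS](inv k (f p)); apply: eq_bigr => i _.
  by rewrite /sgn; case: ifP.
have sD m : shift (\sum_(i < m.+1) sgn i (geom_op U i (G (m - i)%N f))) =
     \sum_(i < m.+1) sgn i (shift (geom_op U i (G (m - i)%N f))).
  rewrite (morphD_sum (@shiftD V)); apply: eq_bigr => i _.
  by rewrite (morph_sgn _ _ (@shiftD V)).
have DS m : D m.+1 f = - shift (D m f).
  rewrite [shift (D m f)]sD.
  have -> : D m.+1 f = D' m.+1 f - \sum_(i < m.+1) sgn i (shift (geom_op U i (G (m - i)%N f))).
    rewrite /D /D' big_ord_recl [in RHS]big_ord_recl -[RHS]addrA; congr (_ + _).
      by rewrite /sgn /= addr0.
    rewrite -sumrN -big_split; apply: eq_bigr => i _ /=.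
    by rewrite sgnD subSS [X in _ + X]sgnS.
  by rewrite D'E add0r.
have -> : \sum_(i < n.+2) sgn i (geom_op U i (lin_op U' (n.+1 - i)%N f)) =
   D n.+1 f + shift (D n f); last by rewrite DS addNr.
rewrite [shift (D n f)]sD.
have sG i h : geom_op U i (shift h) = shift (geom_op U i h).
  elim: i => [|i IH] /=; apply: funext => -[|p].
  - by rewrite seriesD /smap /= (morphD0 (aU _)) addr0.
  - by rewrite seriesD /smap /= seriesD.
  - by rewrite seriesD /smap /= (morphD0 (aU _)) addr0.
  by rewrite IH seriesD /= seriesD.
rewrite /D [in LHS]big_ord_recr [in RHS]big_ord_recr /= [RHS]addrAC.
congr (_ + _); last first.
  by rewrite subnn /lin_op addr0.
rewrite -big_split; apply: eq_bigr => i _ /=.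
have hi : (i <= n)%N by rewrite -ltnS.
by rewrite (subSn hi) -sgnD -sG -aG.
Qed.

(** The index in [series V] records the degree given to the factor h_n: an exponent k splits into k
    - j for U and a shift by j. In the induction the head operator, being outermost, is absorbed
    into [phi]. *)
Lemma conv_hword (V : zmodType) (U : nat -> V -> V) n s (phi : V -> R) v0 :
  (forall k, {morph U k : u v / u + v}) -> {morph phi : u v / u + v} ->
  conv (fun t => phi (run U t v0)) (hword R n) s =
  phi (run (geom_op U) s (sconst v0) n).
Proof.
move=> aU; elim: s n phi => [|k s IH] n phi aphi /=.
  by case: n => [|n]; rewrite /hword /= ?mulr1 // mulr0 (morphD0 aphi).
rewrite geom_opE (morphD_sum aphi) [RHS]big_mkcond (reindex_inj rev_ord_inj) /=.
apply: eq_bigr => j _; have hj : (j <= k)%N by rewrite -ltnS.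
rewrite subSS (subKn hj); case: ifP => hjn.
  rewrite -(IH _ (fun v => phi (U (k - j)%N v))); last by move=> u v; rewrite aU aphi.
  by apply: eq_conv => t _ //; rewrite /hword /= -{1}(subnKC hjn) eqn_add2l.
apply: conv0r => t; rewrite /hword /=; case: eqP => // e.
by rewrite -e leq_addr in hjn.
Qed.

(** Each letter gives e_n an exponent 0 or 1, whence the linear factor in place of the geometric
    one. *)
Lemma conv_eword (V : zmodType) (U : nat -> V -> V) n s (phi : V -> R) v0 :
  (forall k, {morph U k : u v / u + v}) -> {morph phi : u v / u + v} ->
  conv (fun t => phi (run U t v0)) (eword R n) s =
  phi (run (lin_op U) s (sconst v0) n).
Proof.
move=> aU; elim: s n phi => [|k s IH] n phi aphi /=.
  by case: n => [|n]; rewrite /eword /= ?mulr1 // mulr0 (morphD0 aphi).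
have aphiU j : {morph (fun v => phi (U j v)) : u v / u + v}.
  by move=> u v; rewrite aU aphi.
rewrite (reindex_inj rev_ord_inj) big_ord_recl /lin_op seriesD aphi; congr (_ + _).
  rewrite /= subn1 -(IH _ (fun v => phi (U k v))) //.
  by apply: eq_conv => t _ //; rewrite /eword /= subnn.
case: k => [|k] /=; first by rewrite big_ord0 (morphD0 aphi).
rewrite big_ord_recl big1 ?addr0 => [|j _]; last first.
  apply: conv0r => t; rewrite /eword /= /bump /=.
  have -> : (k.+1 - (k.+2 - (1 + (1 + j)).+1) = j.+2)%N by have := ltn_ord j; lia.
  by rewrite andbF.
have -> : (k.+2 - (bump 0 0).+1 = k)%N by rewrite /bump /=; lia.
rewrite subSnn; case: n => [|n]; rewrite /= ?(morphD0 aphi).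
  by apply: conv0r => t; rewrite /eword /= ?add1n.
by rewrite /smap -(IH _ (fun v => phi (U k v))).
Qed.

Lemma omega_pairM F G n : omega_pair F G ->
  omega_pair (fps_mul F (h_series R n)) (fps_mul G (e_series R n)).
Proof.
case=> V U U' phi v0 dU phiD hF hG.
exists (series V) (geom_op U) (lin_op U') (fun f => phi (f n)) (sconst v0).
- exact: geom_lin_dual.
- by move=> u v; rewrite seriesD phiD.
- move=> s; rewrite fps_mulE -(conv_hword _ _ _ (dual_addl dU) phiD).
  by apply: eq_conv => t _; rewrite ?h_seriesE.
move=> s; rewrite fps_mulE -(conv_eword _ _ _ (dual_addr dU) phiD).
by apply: eq_conv => t _; rewrite ?e_seriesE.
Qed.

Lemma conv_hword0 (g : seq nat -> R) s : conv (hword R 0) g s = g s.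
Proof.
elim: s g => [|n s IH] g /=; first by rewrite mul1r.
rewrite big_ord_recl big1 ?addr0 => [|i _]; first by rewrite -[RHS](IH (fun t => g (n :: t))) subn0.
by apply: conv0l => t.
Qed.

Lemma conv_eword0 (g : seq nat -> R) s : conv (eword R 0) g s = g s.
Proof.
elim: s g => [|n s IH] g /=; first by rewrite mul1r.
rewrite big_ord_recl big1 ?addr0 => [|i _]; first by rewrite -[RHS](IH (fun t => g (n :: t))) subn0.
by apply: conv0l => t.
Qed.

(** The closure available is under multiplication by a generator, while the graph has arbitrary
    products. The induction therefore carries an arbitrary pair X, Y on the left, so that a product
    is handled by associativity; at the end X is h_0 = 1. *)
Lemma omega_graph_pair F G : omega_graph F G -> omega_pair F G.
Proof.
have gen : omega_graph F G -> forall X Y, omega_pair X Y ->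
    omega_pair (fps_mul X F) (fps_mul Y G).
  elim=> {F G} [n|F F' H H' _ IF _ IH|c F F' _ IF|F F' H H' _ IF _ IH] X Y hXY.
  - exact: omega_pairM.
  - by rewrite !fps_mulDr; apply: omega_pairD; [apply: IF | apply: IH].
  - by rewrite !fps_mulZr; apply: omega_pairZ; apply: IF.
  - by rewrite -!fps_mulA; apply/IH/IF.
move=> /gen /(_ _ _ omega_pair1).
have -> : fps_mul (h_series R 0) F = F.
  apply: fpsP => s; rewrite fps_mulE -[RHS](conv_hword0 (fun t => F (mon t))).
  by apply: eq_conv => t _; rewrite ?h_seriesE.
have -> // : fps_mul (e_series R 0) G = G.
apply: fpsP => s; rewrite fps_mulE -[RHS](conv_eword0 (fun t => G (mon t))).
by apply: eq_conv => t _; rewrite ?e_seriesE.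
Qed.
End Closure.

(** * Symmetric functions are polynomials in the elementary ones *)

Definition parts (s : seq nat) : seq nat := [seq k <- s | 0 < k]%N.

(** Listed in the order of the finite support, hence meaningful only up to permutation. *)
Definition exponents (m : xmon) : seq nat := [seq m k | k <- enum_fset (finsupp m)].

Lemma perm_parts s : exists n, perm_eq s (parts s ++ nseq n 0%N).
Proof.
exists (size [seq k <- s | ~~ (0 < k)%N]).
have /all_pred1P <- : all (pred1 0%N) [seq k <- s | ~~ (0 < k)%N].
  by apply/allP => k; rewrite mem_filter -eqn0Ngt => /andP[].
by rewrite perm_sym; apply/permPl/perm_filterC.
Qed.

Lemma perm_exponents s : perm_eq (exponents (mon s)) (parts s).
Proof.
have e : s = [seq mon s k | k <- iota 0 (size s)].
  by rewrite -[LHS](mkseq_nth 0%N) /mkseq; apply: eq_map => k; rewrite monE.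
rewrite {2}e /parts filter_map; apply: perm_map; apply: uniq_perm.
- exact: fset_uniq.
- by rewrite filter_uniq ?iota_uniq.
move=> k; rewrite mem_filter mem_iota add0n /= -cmE_neq0 lt0n.
by case: eqP => //; rewrite monE; case: ltnP => // h; rewrite nth_default.
Qed.

Section Fundamental.
Variable R : comNzRingType.
Implicit Types F H : fps R.

(** The offsets p and q stand for the degrees already handed to f and g by the letters consumed in
    the recursion. *)
Lemma conv_homog (f g : seq nat -> R) p q a b s :
  (forall t, (sumn t + p)%N <> a -> f t = 0) ->
  (forall t, (sumn t + q)%N <> b -> g t = 0) ->
  (sumn s + p + q)%N <> (a + b)%N -> conv f g s = 0.
Proof.
elim: s p q f g => [|n s IH] p q f g hf hg /= hs.
  case: (p =P a) => hp; last by rewrite hf ?mul0r.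
  by rewrite hg ?mulr0 //= => hq; apply: hs; rewrite /= -hp -hq.
rewrite big1 // => i _; have hi : (i <= n)%N by rewrite -ltnS.
apply: (IH (i + p)%N ((n - i) + q)%N) => [t ht|t ht|]; last by lia.
  by apply: hf => /=; lia.
by apply: hg => /=; lia.
Qed.

(** A squarefree monomial of degree r on at most r available letters uses each of them exactly
    once. *)
Lemma conv_eword_min (h : seq nat -> R) r s : (size (parts s) <= r)%N ->
  conv (eword R r) h s = if size (parts s) == r then h (map predn s) else 0.
Proof.
elim: s r h => [|n s IH] r h; rewrite [conv _ _ _]/=.
  by rewrite /eword /= andbT eq_sym; case: ifP; rewrite ?mul1r ?mul0r.
case: n => [|n].
  rewrite -[parts (0%N :: s)]/(parts s) => hr.
  by rewrite big_ord1; exact: (IH r (fun t => h (0%N :: t)) hr).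
rewrite -[parts (n.+1 :: s)]/(n.+1 :: parts s) /= => hr.
rewrite big_ord_recl -[X in X + _]/(conv (eword R r) _ s) IH; last exact: ltnW.
rewrite (ltn_eqF hr) add0r big_ord_recl big1 ?addr0 => [|j _]; last first.
  by apply: conv0l => t; rewrite /eword /= andbF.
case: r hr => // r hr; rewrite eqSS /= /bump /= add1n subn1.
by rewrite -(IH r (fun t => h (n :: t))).
Qed.

Definition symmetric_fps F := swap_inv (fun s => F (mon s)).
Definition homogeneous_fps d F := forall m, mdeg m <> d -> F m = 0.

Lemma symmetric_perm F s t : symmetric_fps F -> perm_eq s t -> F (mon s) = F (mon t).
Proof. exact: (@swap_inv_perm _ (fun s => F (mon s))). Qed.

Lemma symmetric_parts F s : symmetric_fps F -> F (mon s) = F (mon (parts s)).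
Proof.
move=> h; have [n e] := perm_parts s.
by rewrite (symmetric_perm h e) mon_cat0.
Qed.

Lemma symmetricM F H : symmetric_fps F -> symmetric_fps H -> symmetric_fps (fps_mul F H).
Proof. by move=> hF hH s1 a b s2; rewrite !fps_mulE; apply: conv_swap. Qed.

Lemma symmetric_e n : symmetric_fps (e_series R n).
Proof.
move=> s1 a b s2; rewrite !e_seriesE /eword !sumn_cat !all_cat /=.
by rewrite (addnCA a b) (andbCA (a <= 1)%N).
Qed.

(* Divides by [e_r] the part of [F] whose monomials involve [r] letters. *)
Definition peel r F : fps R := fun m =>
  let p := exponents m in
  if (size p <= r)%N then F (mon (map succn p ++ nseq (r - size p) 1%N)) else 0.

Lemma peelE r F s : symmetric_fps F -> peel r F (mon s) =
  if (size (parts s) <= r)%N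
  then F (mon (map succn (parts s) ++ nseq (r - size (parts s)) 1%N)) else 0.
Proof.
move=> h; rewrite /peel (perm_size (perm_exponents s)); case: ifP => // _.
by apply: symmetric_perm => //; rewrite perm_cat2r; apply/perm_map/perm_exponents.
Qed.

Lemma symmetric_peel r F : symmetric_fps F -> symmetric_fps (peel r F).
Proof.
move=> h s1 a b s2; rewrite !peelE //.
have e : perm_eq (parts (s1 ++ a :: b :: s2)) (parts (s1 ++ b :: a :: s2)).
  by apply: perm_filter; rewrite perm_cat2l; apply/permPl/(perm_catCA [:: a] [:: b] s2).
rewrite (perm_size e); case: ifP => // _.
by apply: symmetric_perm => //; rewrite perm_cat2r; apply: perm_map.
Qed.

Lemma sumn_parts s : sumn (parts s) = sumn s.
Proof. by elim: s => [//|[|n] s IH] //=; rewrite IH. Qed.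

Lemma sumn_mapS s : sumn (map succn s) = (sumn s + size s)%N.
Proof. by elim: s => //= n s ->; rewrite addSn addnS addnA. Qed.

Lemma size_parts s : (size (parts s) <= sumn s)%N.
Proof. by elim: s => //= -[|n] s IH //=; rewrite addSn ltnS (leq_trans IH) ?leq_addl. Qed.

(** Subtracting this product from an F without monomials in fewer than r letters leaves only
    monomials in more than r letters. *)
Lemma mul_peel r F s : symmetric_fps F -> (size (parts s) <= r)%N ->
  fps_mul (e_series R r) (peel r F) (mon s) =
  if size (parts s) == r then F (mon s) else 0.
Proof.
move=> h hs; rewrite fps_mulE.
rewrite (@eq_conv _ _ (eword R r) _ (fun t => peel r F (mon t))) //; last first.
  by move=> t _; rewrite e_seriesE.
rewrite conv_eword_min //; case: eqP => // e; rewrite peelE //.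
have hle : (size (parts (map predn s)) <= r)%N.
  by rewrite -e; elim: (s) => //= -[|[|n]] u //= hu; exact: leqW.
rewrite hle (symmetric_parts s h); apply: symmetric_perm => //.
rewrite -e; elim: (s) => //= -[|[|n]] u //= hu; last by rewrite subSS perm_cons.
have hu2 : (size (parts (map predn u)) <= size (parts u))%N.
  by elim: (u) => //= -[|[|n]] v //= hv; exact: leqW.
rewrite subSn //=; rewrite -cat1s perm_catCA /= perm_cons; exact: hu.
Qed.

(** Strong induction on the degree and, inside it, on the least number r of letters in a monomial of
    F: the part with r letters is that of e_r times [peel r F], and the latter has degree d - r. The
    preimage is built along the way, with h_r in place of e_r. *)
Lemma symmetric_omega_graph d F : homogeneous_fps d F -> symmetric_fps F ->
  exists H, omega_graph H F.
Proof.
elim/ltn_ind: d F => d IHd F.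
have zero : omega_graph (fps_scale 0 (h_series R 0)) (fun _ => 0).
  have -> : (fun _ : xmon => 0 : R) = fps_scale 0 (e_series R 0).
    by apply: fpsP => s; rewrite /fps_scale mul0r.
  by apply: omega_graph_scale; apply: omega_graph_h.
(* At k = 0 a monomial of F would need more than d letters in degree d, so F is 0. *)
have main k : forall r F, (0 < r)%N -> (r + k)%N = d.+1 -> homogeneous_fps d F -> symmetric_fps F ->
    (forall s, (size (parts s) < r)%N -> F (mon s) = 0) -> exists H, omega_graph H F.
  elim: k => [|k IHk] r {}F r0 hr hF sF vF.
    exists (fps_scale 0 (h_series R 0)).
    suff -> : F = (fun _ => 0) by [].
    apply: fpsP => s; case: (ltnP (size (parts s)) r) => [/vF //|h].
    by apply: hF; rewrite mdeg_mon; move: (size_parts s); lia.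
  have hP : homogeneous_fps (d - r) (peel r F).
    move=> m; have [s ->] := monP m; rewrite mdeg_mon peelE // => hs.
    case: ifP => // hp; apply: hF.
    rewrite mdeg_mon sumn_cat sumn_mapS sumn_parts sumn_nseq; lia.
  have sP := symmetric_peel r sF.
  have [|H1 gH1] := IHd (d - r)%N _ _ hP sP; first by lia.
  set E := fps_mul (e_series R r) (peel r F).
  have [|||||H2 gH2] := IHk r.+1 (fps_add F (fps_scale (-1) E)).
  - by [].
  - by rewrite -hr addSnnS.
  - move=> m; have [s ->] := monP m; rewrite mdeg_mon => hs.
    rewrite /fps_add /fps_scale hF ?mdeg_mon // /E fps_mulE.
    rewrite (@conv_homog _ _ 0 0 r (d - r)) ?mulr0 ?addr0 // => [t|t|].
    + by rewrite addn0 e_seriesE /eword => /eqP /negbTE ->.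
    + by rewrite addn0 => ht; apply: hP; rewrite mdeg_mon.
    + by lia.
  - move=> s1 a b s2; rewrite /fps_add /fps_scale; congr (_ + _ * _); first exact: sF.
    by apply: symmetricM => //; apply: symmetric_e.
  - move=> s; rewrite ltnS => hs; rewrite /fps_add /fps_scale /E mul_peel //.
    case: eqP => [_|/eqP hne]; first by rewrite mulN1r subrr.
    by rewrite mulr0 addr0 vF // ltn_neqAle hne.
  exists (fps_add H2 (fps_mul (h_series R r) H1)).
  have -> : F = fps_add (fps_add F (fps_scale (-1) E)) E.
    by apply: fpsP => s; rewrite /fps_add /fps_scale mulN1r subrK.
  by apply: omega_graph_add => //; apply: omega_graph_mul => //; apply: omega_graph_h.
(* Starting [main] at r = 1 requires a vanishing constant term; in degree 0, F is instead a multiple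
   of e_0. *)
case: d IHd main => [|d] IHd main hF sF.
  have [c hc] : exists c, F (mon [::]) = c by exists (F (mon [::])).
  exists (fps_scale c (h_series R 0)).
  have -> : F = fps_scale c (e_series R 0).
    apply: fpsP => s; rewrite /fps_scale e_seriesE /eword.
    case: natnseq0P => [->|h]; rewrite ?all_nseq ?orbT ?mulr1 ?mulr0.
      by rewrite -[nseq _ _]cat0s mon_cat0 hc.
    by rewrite hF // mdeg_mon => e; apply: h; apply/natnseq0P/eqP.
  by apply: omega_graph_scale; apply: omega_graph_h.
apply: (main d.+1 1%N) => // s; rewrite ltnS leqn0 => /nilP e.
by rewrite hF // mdeg_mon -sumn_parts e.
Qed.
End Fundamental.

(** * The transfer kernel *)

(* Transfer weights for one letter: [S] and [S'] are the sets of cells that are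
   nonempty before and after the letter is inserted; [Hr c c'] (resp. [Vr c c'])
   says that [c'] is the right (resp. lower) neighbour of [c].  A new cell gets
   weight [X c], and an old one that may receive the letter gets [G c]. *)
Section Kernel.
Variables (C : finType) (Hr Vr : rel C) (E : comNzRingType) (X G : C -> E).
Implicit Types S T : {set C}.

(** Letters arrive in increasing order. A right neighbour filled earlier holds a smaller letter and
    closes c, one filled by the same letter does not; columns are strict, so below c the set after
    the insertion counts. *)
Definition blocked S T c :=
  [exists c', (Hr c c' && (c' \in S)) || (Vr c c' && (c' \in T))].

Definition local_weight (old new blk : bool) c : E :=
  if old then if new then if blk then 1 else G c else 0
  else if new then if blk then 0 else X c else 1.

Definition kernel S T : E :=
  \prod_c local_weight (c \in S) (c \in T) (blocked S T c) c.
End Kernel.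

Section Inverse.
Variables (C : finType) (Hr Vr : rel C) (E : comNzRingType) (X G X' G' : C -> E).
Hypothesis GG' : forall c, G c * G' c = 1.
Hypothesis XX' : forall c, X c * G' c + X' c = 0.
Hypothesis corner : forall N : {set C}, N != set0 -> exists2 c, c \in N &
  (forall c', Hr c c' -> c' \notin N) /\
  (forall d, Vr d c -> d \notin N /\ forall c', Hr d c' -> c' \notin N).
Implicit Types S T : {set C}.

Let term S T (K : {set C}) c := local_weight X G (c \in S) (c \in K) (blocked Hr Vr S K c) c *
  local_weight X' G' (c \in K) (c \in T) (blocked Vr Hr K T c) c.

(** If S is strictly inside T, toggling a corner c of T minus S in the middle set K reverses the
    sign: c contributes X G' when in K and X' when not, or 0 both times if blocked, and the product
    of the other factors is unchanged. If S = T, only K = S survives, each cell giving 1 or G G'. *)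
Lemma kernel_inv S T :
  \sum_(K : {set C}) kernel Hr Vr X G S K * kernel Vr Hr X' G' K T = (S == T)%:R.
Proof.
rewrite (eq_bigr (fun K => \prod_c term S T K c)) => [|K _]; last first.
  by rewrite -big_split.
have [sST|/subsetPn [c cS cT]] := boolP (S \subset T); last first.
  have -> : (S == T) = false.
    by apply: contraNF cT => /eqP <-.
  rewrite big1 // => K _; rewrite (bigD1 c) //= {1}/term cS (negbTE cT).
  by case: (c \in K); rewrite /= ?mulr0 ?mul0r.
have [<-|neST] := eqVneq S T.
  rewrite (bigD1 S) //= [X in _ + X]big1 ?addr0; last first.
    move=> K neKS; have [c hc] : exists c, (c \in S) != (c \in K).
      apply/existsP; apply: contraNT neKS; rewrite negb_exists => /forallP h.
      by apply/eqP/setP => c; have := h c; rewrite negbK => /eqP.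
    rewrite (bigD1 c) //= {1}/term; move: hc.
    by case: (c \in S); case: (c \in K) => //= _; rewrite ?mul0r ?mulr0 ?mul0r.
  rewrite big1 // => c _; rewrite /term.
  have -> : blocked Vr Hr S S c = blocked Hr Vr S S c.
    by apply: eq_existsb => d; rewrite orbC.
  by rewrite /local_weight; case: (c \in S); case: (blocked Hr Vr S S c); rewrite ?mulr1 ?GG'.
have N0 : T :\: S != set0.
  by rewrite setD_eq0; apply: contraNN neST => h; rewrite eqEsubset sST.
have [c cN [hH hV]] := corner N0.
have [cT cS] : c \in T /\ c \notin S by move: cN; rewrite inE => /andP[].
have sN d : d \notin T :\: S -> (d \in T) = (d \in S).
  rewrite inE negb_and negbK; case: (boolP (d \in S)) => [/(subsetP sST) -> //|_ /=].
  by move/negbTE.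
pose w (K : {set C}) := \prod_d term S T K d.
have opp (K : {set C}) : c \notin K -> w (c |: K) + w K = 0.
  move=> cK; rewrite /w (bigD1 c) //= [X in _ + X](bigD1 c) //=.
  rewrite (eq_bigr (term S T K)) => [|d dc].
    rewrite -mulrDl; suff -> : term S T (c |: K) c + term S T K c = 0 by rewrite mul0r.
    rewrite /term cT (negbTE cS) (negbTE cK) setU11.
    have VN d : Vr c d -> d != c by move=> h; apply/eqP => e; move: h; rewrite e => /hV []; rewrite cN.
    have e1 : blocked Hr Vr S (c |: K) c = blocked Vr Hr K T c.
      apply: eq_existsb => d; rewrite orbC in_setU1; congr (_ || _).
        by case: (boolP (Vr c d)) => //= /VN /negbTE ->.
      by case: (boolP (Hr c d)) => //= /hH /sN ->.
    have e2 : blocked Vr Hr (c |: K) T c = blocked Vr Hr K T c.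
      apply: eq_existsb => d; rewrite in_setU1; congr (_ || _).
      by case: (boolP (Vr c d)) => //= /VN /negbTE ->.
    rewrite e1 e2 /local_weight; case: (blocked Vr Hr K T c); first by rewrite mul0r mulr0 addr0.
    by rewrite mul1r XX'.
  rewrite /term in_setU1 (negbTE dc) /=.
  (* Only a cell d above c sees the toggle. Neither d nor its right neighbours lie in T minus S, so
     its two factors multiply to 1 whether it is blocked or not, unless K makes one of them 0. *)
  have [/hV [dN hd]|nV] := boolP (Vr d c); last first.
    have mK e : Vr d e -> (e \in c |: K) = (e \in K).
      by move=> h; rewrite in_setU1; case: eqP => // ec; rewrite -ec h in nV.
    have -> : blocked Hr Vr S (c |: K) d = blocked Hr Vr S K d.
      by apply: eq_existsb => e; case: (boolP (Vr d e)) => //= /mK ->.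
    have -> // : blocked Vr Hr (c |: K) T d = blocked Vr Hr K T d.
    by apply: eq_existsb => e; case: (boolP (Vr d e)) => //= /mK ->.
  rewrite (sN _ dN) /local_weight.
  have e1 L : blocked Vr Hr L T d = blocked Hr Vr S L d.
    apply: eq_existsb => e; rewrite orbC; congr (_ || _).
    by case: (boolP (Hr d e)) => //= /hd /sN ->.
  rewrite !e1; case: (d \in S); case: (d \in K); rewrite ?mul0r ?mulr0 //.
  by case: (blocked Hr Vr S K d); case: (blocked Hr Vr S (c |: K) d); rewrite ?mulr1 ?GG'.
rewrite (bigID (fun K : {set C} => c \in K)) /=.
rewrite (reindex_onto (fun K : {set C} => c |: K) (fun K => K :\ c)) /=; last first.
  by move=> K cK; rewrite setD1K.
rewrite (eq_bigl (fun K : {set C} => c \notin K)) => [|K]; last first.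
  rewrite setU11 /=; case: (boolP (c \in K)) => cK /=.
    by apply/eqP => e; move: (setD11 c (c |: K)); rewrite e cK.
  by rewrite setU1K ?eqxx.
by rewrite -big_split big1 // => K /opp.
Qed.
End Inverse.

(** * Tableaux as sequences of letter insertions *)

(* A cell content is encoded by listing, for each letter, its multiplicity and
   whether its first occurrence is marked. *)
Definition block (k : nat) (q : nat * bool) : seq (nat * bool) :=
  if q.1 is n.+1 then (k, q.2) :: nseq n (k, false) else [::].

Fixpoint blocks (k : nat) (qs : seq (nat * bool)) : seq (nat * bool) :=
  if qs is q :: qs' then block k q ++ blocks k.+1 qs' else [::].

Definition mult (k : nat) (t : seq (nat * bool)) := count (fun p => p.1 == k) t.

Definition code (k N : nat) (t : seq (nat * bool)) : seq (nat * bool) :=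
  [seq (mult j t, (j, true) \in t) | j <- iota k N].

(** An absent letter has no first occurrence to mark; this makes codes unique. *)
Definition normal (q : nat * bool) := (0 < q.1)%N || ~~ q.2.

Lemma mark_rel_trans : transitive mark_rel.
Proof.
move=> q p r /andP[h1 h2] /andP[h3 h4]; rewrite /mark_rel (leq_trans h1 h3) /=.
by apply/implyP => /(implyP h4); apply: leq_ltn_trans.
Qed.

Lemma mem_block k q p : p \in block k q -> p.1 = k.
Proof.
rewrite /block; case: q.1 => // n; rewrite inE => /orP[/eqP -> //|].
by rewrite mem_nseq => /andP[_ /eqP ->].
Qed.

Lemma mem_blocks k qs p : p \in blocks k qs -> (k <= p.1)%N.
Proof.
elim: qs k => [//|q qs IH] k /=; rewrite mem_cat => /orP[/mem_block -> //|/IH].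
exact: ltnW.
Qed.

Lemma mult_block k j q : mult j (block k q) = if k == j then q.1 else 0%N.
Proof.
rewrite /mult /block; case: q => -[|n] b /=; first by rewrite if_same.
by rewrite count_nseq /=; case: eqP; rewrite ?mul1n.
Qed.

Lemma mult_blocks_lt j k qs : (j < k)%N -> mult j (blocks k qs) = 0%N.
Proof.
move=> h; apply/eqP; rewrite -leqn0 leqNgt -has_count; apply/hasP => -[p /mem_blocks hp /eqP e].
by rewrite -e ltnNge hp in h.
Qed.

Lemma codeK k qs : all normal qs -> code k (size qs) (blocks k qs) = qs.
Proof.
elim: qs k => [//|[n b] qs IH] k /= /andP[nq nqs].
rewrite -[code _ _ _]/((mult k (block k (n, b) ++ blocks k.+1 qs),
  (k, true) \in block k (n, b) ++ blocks k.+1 qs) ::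
  code k.+1 (size qs) (block k (n, b) ++ blocks k.+1 qs)).
congr cons.
  rewrite /mult count_cat -!/(mult _ _) mult_block eqxx mult_blocks_lt // addn0.
  congr pair; rewrite mem_cat orbC.
  have -> : ((k, true) \in blocks k.+1 qs) = false.
    by apply/negP => /mem_blocks; rewrite ltnn.
  move: nq; rewrite /block /normal; case: n => [|n] /=; first by case: b.
  by rewrite inE mem_nseq !xpair_eqE eqxx andbF orbF; case: b.
rewrite -[RHS](IH k.+1 nqs); apply/eq_in_map => j; rewrite mem_iota => /andP[hj _].
rewrite /mult count_cat -!/(mult _ _) mult_block (ltn_eqF hj) add0n; congr pair.
rewrite mem_cat; case: (boolP ((j, true) \in block _ _)) => // /mem_block /= e.
by rewrite e ltnn in hj.
Qed.

(** [mark_rel] forbids a mark on a repetition, so the copies of k form a block in which only the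
    first can be marked. *)
Lemma sorted_split k t : sorted mark_rel t -> all (fun p => k <= p.1)%N t ->
  t = block k (mult k t, (k, true) \in t) ++ [seq p <- t | (k < p.1)%N].
Proof.
elim: t => [//|[j b] t IH] hs /andP[hj ht].
have h2 : all (mark_rel (j, b)) t by move: hs; rewrite /= (path_sortedE mark_rel_trans) => /andP[].
have {hs} hs : sorted mark_rel t by apply: path_sorted hs.
have {}hj : (k <= j)%N := hj.
move: hj; rewrite leq_eqVlt => /orP[/eqP ej|hj].
  subst j; rewrite /= ltnn {1}(IH hs ht) /mult /= eqxx add1n.
  have -> : ((k, true) \in t) = false.
    by apply/negP => /(allP h2); rewrite /mark_rel /= ltnn andbF.
  rewrite inE xpair_eqE eqxx /=.
  have -> : ((k, true) \in t) = false.
    by apply/negP => /(allP h2); rewrite /mark_rel /= ltnn andbF.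
  rewrite orbF /block /=; case: b {h2} => /=; case: (count _ t) => //.
rewrite [filter _ _]/= hj.
have gt p : p \in (j, b) :: t -> (k < p.1)%N.
  rewrite inE => /orP[/eqP -> //|/(allP h2) /andP[/(leq_trans hj)]] //.
have -> : [seq p <- t | (k < p.1)%N] = t.
  by apply/all_filterP/allP => p pt; apply: gt; rewrite inE pt orbT.
have -> : mult k ((j, b) :: t) = 0%N.
  apply/eqP; rewrite -leqn0 leqNgt -has_count; apply/hasP => -[p /gt hp /eqP e].
  by rewrite e ltnn in hp.
by [].
Qed.

Lemma blocksK k N t : sorted mark_rel t ->
  all (fun p => k <= p.1 < k + N)%N t -> blocks k (code k N t) = t.
Proof.
elim: N k t => [|N IH] k t hs ht.
  by case: t ht {hs} => // p t /= /andP[]; rewrite addn0 ltnNge; case: leqP.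
have hk : all (fun p => k <= p.1)%N t by apply: sub_all ht => p /andP[].
rewrite [RHS](sorted_split hs hk) /=; congr cat.
set t2 := [seq p <- t | (k < p.1)%N].
rewrite -[RHS](IH k.+1); last 2 first.
- exact: sorted_filter mark_rel_trans _ _ hs.
- apply/allP => p; rewrite mem_filter => /andP[h1 /(allP ht)] /andP[_].
  by rewrite h1 addSnnS.
congr blocks; apply/eq_in_map => j; rewrite mem_iota => /andP[hj _]; congr pair.
  by rewrite /mult count_filter; apply: eq_count => p /=; case: eqP => // ->; rewrite hj.
by rewrite mem_filter /= hj.
Qed.

Lemma sorted_block_cat k q t : all (fun p => k < p.1)%N t ->
  sorted mark_rel (block k q ++ t) = sorted mark_rel t.
Proof.
move=> h; rewrite /block; case: q.1 => [//|n] /=.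
have hk b : path mark_rel (k, b) t = sorted mark_rel t.
  rewrite (path_sortedE mark_rel_trans); case: (boolP (all _ t)) => //= /negP [].
  by apply: sub_all h => p hp; rewrite /mark_rel /= ltnW //= hp implybT.
elim: n q.2 => [|n IH] b /=; first exact: hk.
by rewrite IH /mark_rel /= leqnn.
Qed.

(** Comparing all letters, rather than maximum with minimum, is compatible with concatenation and
    holds for empty lists, as partial tableaux require. *)
Lemma allrel_marked (r : rel nat) s t : (forall x y z w : nat, r y z -> x <= y -> z <= w -> r x w)%N ->
  is_marked_multiset s -> is_marked_multiset t ->
  allrel (fun p q => r p.1 q.1) s t = r (max_letter s) (min_letter t).
Proof.
move=> mono; case: s => // p s /andP[_ hs]; case: t => // q t /andP[_ ht].
have hq u : u \in q :: t -> (q.1 <= u.1)%N.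
  rewrite inE => /orP[/eqP -> //|]; move: u.
  by apply/allP; move: ht; rewrite (path_sortedE mark_rel_trans) => /andP[h _]; apply: sub_all h => u /andP[].
have hp u : u \in p :: s -> (u.1 <= (last p s).1)%N.
  elim: s p hs u => [|p' s IH] p /= hs u; first by rewrite inE => /eqP ->.
  move: hs => /andP[/andP[h1 _] h2]; rewrite inE => /orP[/eqP ->|/(IH _ h2)] //.
  by apply: leq_trans h1 _; apply: (IH _ h2); rewrite mem_head.
apply/allrelP/idP => [h|h u v /hp h1 /hq h2]; last exact: mono h h1 h2.
by apply: (h (last p s) q); rewrite ?mem_last ?mem_head.
Qed.

(** * Partial tableaux and the weight of one insertion *)

Section Run.
Variables (C : finType) (Hr Vr : rel C) (R : comNzRingType) (a b : C -> R) (D : nat).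
Implicit Types (S : {set C}) (g : {ffun C -> 'I_D.+1 * bool}) (c : C)
  (T : C -> seq (nat * bool)).

Definition entry g c : nat * bool := (nat_of_ord (g c).1, (g c).2).

(** The first entry of a cell is free, so n + 1 copies in a new cell weigh a^n; in an old cell they
    weigh a^(n+1), or b a^n if the first is marked. Codes that are not [normal] weigh 0. *)
Definition cell_step (old new blk : bool) c (q : nat * bool) : R :=
  if old then
    if new then
      if q.1 is n.+1 then
        if blk then 0 else if q.2 then b c * a c ^+ n else a c ^+ n.+1
      else (~~ q.2)%:R
    else 0
  else if new then
    if q.1 is n.+1 then if blk || q.2 then 0 else a c ^+ n else 0
  else ((q.1 == 0%N) && ~~ q.2)%:R.

Definition step S S' g : R :=
  \prod_c cell_step (c \in S) (c \in S') (blocked Hr Vr S S' c) c (entry g c).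

Definition receivers g : {set C} := [set c | 0 < (entry g c).1]%N.

Fixpoint run_weight S (f : seq {ffun C -> 'I_D.+1 * bool}) : R :=
  if f is g :: f' then
    step S (S :|: receivers g) g * run_weight (S :|: receivers g) f'
  else (S == setT)%:R.

Definition tab k (f : seq {ffun C -> 'I_D.+1 * bool}) c :=
  blocks k [seq entry g c | g <- f].

Definition head_unmarked (t : seq (nat * bool)) := if t is p :: _ then ~~ p.2 else false.

(** Here T lists the letters still to come. A cell of S has already received smaller ones, so its
    list may be empty or start with a mark. *)
Definition cell_ok S T c :=
  sorted mark_rel (T c) && ((c \in S) || head_unmarked (T c)).

(** A cell c' of S holds a letter smaller than those still to come, so c can receive nothing
    more. *)
Definition pair_ok (r : rel nat) S T c c' :=
  ((c' \in S) ==> nilp (T c)) && allrel (fun p q => r p.1 q.1) (T c) (T c').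

Definition valid S T :=
  [&& [forall c, cell_ok S T c],
      [forall c, forall c', Hr c c' ==> pair_ok leq S T c c'] &
      [forall c, forall c', Vr c c' ==> pair_ok ltn S T c c']].

Definition weight S T : R :=
  \prod_c (a c ^+ (unmarked (T c) - (c \notin S)) * b c ^+ marked (T c)).

Definition step_cell_ok S S' g c :=
  [&& normal (entry g c),
      (0 < (entry g c).1)%N ==> ~~ blocked Hr Vr S S' c &
      (0 < (entry g c).1)%N && (c \notin S) ==> ~~ (entry g c).2].

Definition step_cell_weight S g c : R :=
  if (entry g c).1 is n.+1 then
    if c \in S then if (entry g c).2 then b c * a c ^+ n else a c ^+ n.+1 else a c ^+ n
  else 1.

Lemma stepE S g : step S (S :|: receivers g) g =
  if [forall c, step_cell_ok S (S :|: receivers g) g c]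
  then \prod_c step_cell_weight S g c else 0.
Proof.
rewrite /step; case: (boolP [forall c, _]) => [/forallP h|].
  apply: eq_bigr => c _; have := h c; rewrite /step_cell_ok /cell_step /step_cell_weight.
  rewrite !inE /normal; case: (entry g c) => -[|n] fl /=; rewrite ?orbF ?orbT.
    by case: fl => //=; case: (c \in S).
  case: blocked => //=; case: (c \in S) => //=; case: fl => //.
rewrite negb_forall => /existsP[c hc]; rewrite (bigD1 c) //=.
suff -> : cell_step (c \in S) (c \in S :|: receivers g)
    (blocked Hr Vr S (S :|: receivers g) c) c (entry g c) = 0 by rewrite mul0r.
move: hc; rewrite /step_cell_ok /cell_step !inE /normal.
case: (entry g c) => -[|n] fl /=; rewrite ?orbF ?orbT.
  by case: fl => //=; case: (c \in S).
by case: blocked => //=; case: (c \in S) => //=; case: fl.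
Qed.

Lemma step0 S S' g : S' != S :|: receivers g -> step S S' g = 0.
Proof.
move=> neS; have [c hc] : exists c, (c \in S') != (c \in S :|: receivers g).
  apply/existsP; apply: contraNT neS; rewrite negb_exists => /forallP h.
  by apply/eqP/setP => c; have := h c; rewrite negbK => /eqP.
rewrite /step (bigD1 c) //=; move: hc; rewrite !inE /cell_step.
by case: (entry g c) => -[|n] fl /=; case: (c \in S); case: (c \in S'); rewrite //= ?mul0r.
Qed.

Section Step.
Variables (k : nat) (S : {set C}) (g : {ffun C -> 'I_D.+1 * bool}).
Variable T : C -> seq (nat * bool).
Hypothesis Tk : forall c, all (fun p => k < p.1)%N (T c).
Let S' := S :|: receivers g.
Let T1 c := block k (entry g c) ++ T c.

Let in_S' c : (c \in S') = (c \in S) || (0 < (entry g c).1)%N.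
Proof. by rewrite !inE. Qed.

Lemma cell_ok_step c : cell_ok S T1 c =
  ((0 < (entry g c).1)%N && (c \notin S) ==> ~~ (entry g c).2) && cell_ok S' T c.
Proof.
rewrite /cell_ok /T1 sorted_block_cat // in_S' /block.
case: (entry g c) => -[|n] fl /=; rewrite ?orbF ?orbT ?andbT //.
by rewrite andbC; case: (c \in S).
Qed.

Lemma nilp_T1 c : nilp (T1 c) = ((entry g c).1 == 0%N) && nilp (T c).
Proof. by rewrite /T1 /block; case: (entry g c) => -[|n] fl. Qed.

Lemma allrel_true (r : rel (nat * bool)) s t :
  {in s & t, forall p q, r p q} -> allrel r s t.
Proof. by move=> h; apply/allrelP. Qed.

Lemma allrel_false (r : rel (nat * bool)) s t :
  {in s & t, forall p q, r p q = false} -> allrel r s t = nilp s || nilp t.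
Proof.
case: s => [//|p s]; case: t => [|q t] h; first by rewrite allrel0r orbT.
by apply/negbTE/allrelP => /(_ p q); rewrite !mem_head h ?mem_head // => /(_ isT isT).
Qed.

Lemma nilp_block q : nilp (block k q) = (q.1 == 0%N).
Proof. by case: q => -[]. Qed.

Lemma allrel_leq_step c c' :
  allrel (fun p q => (p.1 <= q.1)%N) (T1 c) (T1 c') =
  (nilp (T c) || ((entry g c').1 == 0%N)) &&
  allrel (fun p q => (p.1 <= q.1)%N) (T c) (T c').
Proof.
rewrite /T1 allrel_catl !allrel_catr.
rewrite [X in X && _ && _]allrel_true => [|p q /mem_block -> /mem_block ->] //.
rewrite [X in X && _]allrel_true => [|p q /mem_block -> /(allP (Tk c'))] //; last exact: ltnW.
rewrite /= [X in X && _]allrel_false ?nilp_block // => p q /(allP (Tk c)) h /mem_block ->.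
by rewrite leqNgt h.
Qed.

Lemma allrel_ltn_step c c' :
  allrel (fun p q => (p.1 < q.1)%N) (T1 c) (T1 c') =
  ((nilp (T c) && ((entry g c).1 == 0%N)) || ((entry g c').1 == 0%N)) &&
  allrel (fun p q => (p.1 < q.1)%N) (T c) (T c').
Proof.
rewrite /T1 allrel_catl !allrel_catr.
rewrite [X in X && _ && _]allrel_false; last first.
  by move=> p q /mem_block -> /mem_block ->; rewrite ltnn.
rewrite [X in _ && X && _]allrel_true => [|p q /mem_block -> /(allP (Tk c'))] //.
rewrite [X in _ && (X && _)]allrel_false => [|p q /(allP (Tk c)) h /mem_block ->]; last first.
  by rewrite ltnNge ltnW.
rewrite !nilp_block andbT andbA; congr (_ && _).
by case: (nilp _); case: (_ == _); case: (_ == _).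
Qed.

Lemma pair_ok_leq_step c c' : pair_ok leq S T1 c c' =
  ((0 < (entry g c).1)%N ==> (c' \notin S)) && pair_ok leq S' T c c'.
Proof.
rewrite /pair_ok nilp_T1 in_S' !lt0n allrel_leq_step.
case: (c' \in S); case: (nilp (T c)); case: ((entry g c).1 == 0%N);
  by case: ((entry g c').1 == 0%N).
Qed.

Lemma pair_ok_ltn_step c c' : pair_ok ltn S T1 c c' =
  ((0 < (entry g c).1)%N ==> (c' \notin S')) && pair_ok ltn S' T c c'.
Proof.
rewrite /pair_ok nilp_T1 in_S' !lt0n allrel_ltn_step.
case: (c' \in S); case: (nilp (T c)); case: ((entry g c).1 == 0%N);
  by case: ((entry g c').1 == 0%N).
Qed.

(** The conditions on the block of the least letter k are [step_cell_ok]; that no later letter may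
    enter c once its neighbour has received k is absorbed in the passage from S to S'. *)
Lemma valid_step : [forall c, normal (entry g c)] && valid S T1 =
  [forall c, step_cell_ok S S' g c] && valid S' T.
Proof.
apply/andP/andP => -[].
  move=> /forallP n /and3P[/forallP h1 /'forall_forallP h2 /'forall_forallP h3].
  split.
    apply/forallP => c; have := h1 c; rewrite cell_ok_step => /andP[hc _].
    rewrite /step_cell_ok n hc andbT /=; apply/implyP => gc.
    rewrite /blocked negb_exists; apply/forallP => c'; rewrite negb_or.
    apply/andP; split; apply/negP => /andP[hh c'S].
      by have := implyP (h2 c c') hh; rewrite pair_ok_leq_step gc c'S.
    by have := implyP (h3 c c') hh; rewrite pair_ok_ltn_step gc c'S.
  apply/and3P; split.
  - by apply/forallP => c; have := h1 c; rewrite cell_ok_step => /andP[].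
  - apply/'forall_forallP => c c'; apply/implyP => /(implyP (h2 c c')).
    by rewrite pair_ok_leq_step => /andP[].
  apply/'forall_forallP => c c'; apply/implyP => /(implyP (h3 c c')).
  by rewrite pair_ok_ltn_step => /andP[].
move=> /forallP ok /and3P[/forallP h1 /'forall_forallP h2 /'forall_forallP h3].
have nb c c' : (0 < (entry g c).1)%N ->
    (Hr c c' ==> (c' \notin S)) && (Vr c c' ==> (c' \notin S')).
  move=> gc; have /and3P[_ + _] := ok c; rewrite gc /= /blocked negb_exists.
  move=> /forallP /(_ c'); rewrite negb_or !negb_and -!implybE.
  by case: (Hr c c'); case: (Vr c c').
split; first by apply/forallP => c; have /and3P[] := ok c.
apply/and3P; split.
- by apply/forallP => c; rewrite cell_ok_step h1 andbT; have /and3P[] := ok c.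
- apply/'forall_forallP => c c'; apply/implyP => hc.
  rewrite pair_ok_leq_step (implyP (h2 c c') hc) andbT.
  by apply/implyP => /(nb c c') /andP[/implyP /(_ hc)].
apply/'forall_forallP => c c'; apply/implyP => hc.
rewrite pair_ok_ltn_step (implyP (h3 c c') hc) andbT.
by apply/implyP => /(nb c c') /andP[_ /implyP /(_ hc)].
Qed.

Lemma weight_step : [forall c, step_cell_ok S S' g c] -> valid S' T ->
  weight S T1 = (\prod_c step_cell_weight S g c) * weight S' T.
Proof.
move=> /forallP ok /and3P[/forallP h1 _ _]; rewrite /weight -big_split /=.
apply: eq_bigr => c _; have := ok c; have := h1 c.
rewrite /step_cell_ok /step_cell_weight /cell_ok /T1 in_S' /block.
case: (entry g c) => -[|n] fl /=; first by rewrite !orbF mul1r.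
rewrite orbT /unmarked /marked !count_cat /= !count_nseq /= mul0n add0n mul1n subn0.
move=> _ /andP[_]; case: (c \in S) => /=.
  move=> _; case: fl; rewrite ?subn0 /= ?add0n ?mul0n ?mul1n !exprD ?expr0 ?expr1 ?exprS;
      move: (a c ^+ n) (a c ^+ count _ _) (b c ^+ count _ _) => u v w; ring.
by case: fl => //= _; rewrite addKn add0n exprD mulrA.
Qed.
End Step.

(** At S = [set0] partial tableaux are tableaux, by [valid0] and [weight0]. *)
Lemma run_weightE k S f : run_weight S f =
  if all (fun g => [forall c, normal (entry g c)]) f && valid S (tab k f)
  then weight S (tab k f) else 0.
Proof.
elim: f k S => [|g f IH] k S.
  rewrite [LHS]/= [all _ _]/=.
  have -> : valid S (tab k [::]) = (S == setT).
    rewrite /valid -subTset; apply/and3P/subsetP => [[/forallP h _ _] c _|h].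
      by have := h c; rewrite /cell_ok /= orbF.
    split; first by apply/forallP => c; rewrite /cell_ok /= h.
      by apply/'forall_forallP => c c'; rewrite /pair_ok [nilp _]/= !implybT.
    by apply/'forall_forallP => c c'; rewrite /pair_ok [nilp _]/= !implybT.
  case: eqP => //= _; rewrite /weight big1 // => c _.
  by rewrite [tab _ _ _]/= mul1r.
have Tk c : all (fun p => k < p.1)%N (tab k.+1 f c).
  by apply/allP => p /mem_blocks.
have vs := valid_step S g Tk; have ws := @weight_step k S g (tab k.+1 f).
rewrite [LHS]/= stepE (IH k.+1) [all _ _]/= andbAC.
rewrite -[tab k (g :: f)]/(fun c => block k (entry g c) ++ tab k.+1 f c) vs -andbA.
case: ifP => [ok|_]; last by rewrite mul0r.
rewrite andbC andTb andbC; case: ifP => [/andP[_ v]|_]; last by rewrite mulr0.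
by rewrite ws.
Qed.
End Run.

Fixpoint all_lists (G : finType) n : seq (seq G) :=
  if n is n'.+1 then [seq g :: f | g <- enum G, f <- all_lists G n'] else [:: [::]].

Lemma all_lists_uniq (G : finType) n : uniq (all_lists G n).
Proof.
elim: n => [//|n IH]; apply: allpairs_uniq; rewrite ?enum_uniq //.
by move=> [? ?] [? ?] _ _ /= [-> ->].
Qed.

Lemma mem_all_lists (G : finType) n f : (f \in all_lists G n) = (size f == n).
Proof.
elim: n f => [|n IH] [|g f] //; rewrite ?inE //.
  by apply/negP => /allpairsP[[]] ? ? [].
rewrite eqSS -IH; apply/allpairsP/idP => [[[g' f'] [_ h [_ ->]]]|h] //.
by exists (g, f); rewrite mem_enum.
Qed.

(** * Tableau sums as sums over insertion histories *)

Section Sum.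
Variables (C : finType) (Hr Vr : rel C) (R : comNzRingType) (a b : C -> R).
Implicit Types (T : C -> seq (nat * bool)).

(** Cells and neighbour relations are abstract, so that a transposed tableau can live on the same
    cells with the relations exchanged. *)
Definition tableau T : bool :=
  [&& [forall c, is_marked_multiset (T c)],
      [forall c, forall c', Hr c c' ==> (max_letter (T c) <= min_letter (T c'))%N] &
      [forall c, forall c', Vr c c' ==> (max_letter (T c) < min_letter (T c'))%N]].

Definition tableau_xweight T : xmon :=
  \big[mmul/mone]_(c : C) \big[mmul/mone]_(p <- T c) ucm p.1.

Definition tableau_weight T : R :=
  \prod_c (a c ^+ (unmarked (T c)).-1 * b c ^+ marked (T c)).

Definition filling (m : xmon) :=
  {ffun C -> {bseq (mdeg m) of (finsupp m * bool)%type}}.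

Definition letters (m : xmon) (B : filling m) c : seq (nat * bool) :=
  [seq (val p.1, p.2) | p <- B c].

Definition tableau_sum : fps R := fun m =>
  \sum_(B : filling m | tableau (letters B) && (tableau_xweight (letters B) == m))
     tableau_weight (letters B).

Lemma tableau_xweightE T k : tableau_xweight T k = (\sum_c mult k (T c))%N.
Proof.
rewrite (big_morph (fun m : xmon => m k) (id1 := 0%N) (op1 := addn)); last first.
- exact: cm1.
- by move=> m1 m2; apply: cmM.
apply: eq_bigr => c _; rewrite (big_morph (fun m : xmon => m k) (id1 := 0%N) (op1 := addn)); last first.
- exact: cm1.
- by move=> m1 m2; apply: cmM.
rewrite /mult -sum1_count [RHS]big_mkcond; apply: eq_bigr => p _.
by rewrite cmU; case: eqP.
Qed.

Lemma valid0 T : valid Hr Vr set0 T = tableau T.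
Proof.
have e c : cell_ok set0 T c = is_marked_multiset (T c).
  rewrite /cell_ok inE /=; case: (T c) => //= p t; by rewrite andbC.
rewrite /valid /tableau (eq_forallb e).
case: (boolP [forall c, is_marked_multiset (T c)]) => //= /forallP h.
congr (_ && _); apply: eq_forallb => c; apply: eq_forallb => c'; congr (_ ==> _);
  rewrite /pair_ok inE /=.
- by apply: (@allrel_marked leq) => // x y z w h1 h2 h3; apply: leq_trans h2 (leq_trans h1 h3).
- by apply: (@allrel_marked ltn) => // x y z w h1 h2 h3; apply: leq_ltn_trans h2 (leq_trans h1 h3).
Qed.

Lemma weight0 T : weight a b set0 T = tableau_weight T.
Proof. by apply: eq_bigr => c _; rewrite inE subn1. Qed.

Definition content D (g : {ffun C -> 'I_D.+1 * bool}) : nat :=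
  (\sum_c (entry g c).1)%N.

Lemma mult_tab D k (f : seq {ffun C -> 'I_D.+1 * bool}) c i : (i < size f)%N ->
  mult (k + i) (tab k f c) = (nth (0%N, false) [seq entry g c | g <- f] i).1.
Proof.
elim: f k i => [//|g f IH] k [|i] /= hi; rewrite /mult count_cat -!/(mult _ _) mult_block.
  by rewrite addn0 eqxx mult_blocks_lt ?addn0.
by rewrite -addSnnS IH // ltn_eqF ?add0n // addSn ltnS leq_addr.
Qed.

Lemma mult_tab_out D k (f : seq {ffun C -> 'I_D.+1 * bool}) c i : (k + size f <= i)%N ->
  mult i (tab k f c) = 0%N.
Proof.
elim: f k i => [//|g f IH] k i /= hi; rewrite /mult count_cat -!/(mult _ _) mult_block.
by rewrite IH ?addSnnS // ltn_eqF // (leq_trans _ hi) // addnS ltnS leq_addr.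
Qed.

Lemma content_nth D (f : seq {ffun C -> 'I_D.+1 * bool}) i : (i < size f)%N ->
  nth 0%N (map (@content D) f) i = (\sum_c mult i (tab 0 f c))%N.
Proof.
move=> hi; rewrite (nth_map [ffun=> (ord0, false)]) //; apply: eq_bigr => c _.
by rewrite -{2}(add0n i) mult_tab // (nth_map [ffun=> (ord0, false)]).
Qed.

(** Fillings correspond to lists of codes, one for each letter below [size s]; the total degree
    bounds every multiplicity. *)
Lemma tableau_sum_run D s : (sumn s <= D)%N ->
  tableau_sum (mon s) =
  \sum_(f <- all_lists {ffun C -> 'I_D.+1 * bool} (size s) | map (@content D) f == s)
     run_weight Hr Vr a b set0 f.
Proof.
move=> hD; set N := size s; set m := mon s.
pose Q (f : seq {ffun C -> 'I_D.+1 * bool}) := [&& map (@content D) f == s,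
  all (fun g => [forall c, normal (entry g c)]) f & tableau (tab 0 f)].
transitivity (\sum_(f <- all_lists {ffun C -> 'I_D.+1 * bool} N | Q f)
    tableau_weight (tab 0 f)); last first.
  rewrite big_mkcond [RHS]big_mkcond; apply: eq_bigr => f _.
  rewrite (run_weightE _ _ _ _ 0%N) valid0 weight0 /Q.
  by case: (_ == s).
pose P (B : filling m) := tableau (letters B) && (tableau_xweight (letters B) == m).
pose F (B : filling m) := mkseq (fun k => [ffun c =>
  (inord (mult k (letters B c)) : 'I_D.+1, (k, true) \in letters B c)]) N.
have letN (B : filling m) c p : p \in letters B c -> (p.1 < N)%N.
  move=> /mapP[q _ ->] /=; rewrite ltnNge; apply/negP => h.
  have := fsvalP q.1; rewrite -cmE_neq0 /m monE nth_default ?eqxx //.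
have multD (B : filling m) c k : (mult k (letters B c) < D.+1)%N.
  rewrite ltnS (leq_trans (count_size _ _)) // size_map (leq_trans (size_bseq _)) //.
  by rewrite mdeg_mon.
have entF (B : filling m) c : [seq entry g c | g <- F B] = code 0 N (letters B c).
  rewrite -map_comp; apply: eq_map => k /=.
  by rewrite /entry ffunE /= inordK // multD.
have tabF (B : filling m) : P B -> tab 0 (F B) = letters B.
  move=> /andP[/and3P[/forallP h _ _] _]; apply: funext => c.
  rewrite /tab entF blocksK //; first by have := h c; case: (letters B c) => // p t /andP[].
  by apply/allP => p /letN; rewrite add0n.
have pe : perm_eq [seq F B | B <- enum P] [seq f <- all_lists _ N | Q f].
  apply: uniq_perm; rewrite ?filter_uniq ?all_lists_uniq //.
    rewrite map_inj_in_uniq ?enum_uniq // => B B'; rewrite !mem_enum => hB hB' e.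
    apply/ffunP => c; apply: val_inj.
    have : letters B c = letters B' c by rewrite -tabF // e tabF.
    by apply: inj_map => -[x i] [y j] /= [/val_inj -> ->].
  move=> f; rewrite mem_filter mem_all_lists; apply/mapP/andP => [[B]|[]].
    rewrite mem_enum => hB ->; rewrite size_mkseq eqxx; split=> //.
    have [h1 /eqP h2] := andP hB.
    rewrite /Q tabF // h1 andbT; apply/andP; split.
      apply/eqP; apply: (@eq_from_nth _ 0%N); rewrite ?size_map ?size_iota // => i hi.
      rewrite content_nth ?size_map ?size_iota // tabF // -tableau_xweightE h2.
      exact: monE.
    apply/allP => g /mapP[k _ ->]; apply/forallP => c.
    rewrite /normal /entry ffunE /= inordK ?multD //.
    case: (boolP ((k, true) \in _)); rewrite ?orbT // orbF => h.
    by rewrite -has_count; apply/hasP; exists (k, true).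
  move=> /and3P[/eqP hc hn ht] /eqP hs.
  have sf : size f = N by [].
  have mE k : (\sum_c mult k (tab 0 f c))%N = m k.
    rewrite /m monE; case: (ltnP k N) => hk; first by rewrite -content_nth ?sf // hc.
    by rewrite nth_default // big1 // => c _; rewrite mult_tab_out // sf.
  have inm c p : p \in tab 0 f c -> p.1 \in finsupp m.
    move=> hp; rewrite -cmE_neq0 -mE -lt0n (bigD1 c) //= addn_gt0.
    by rewrite -has_count; apply/orP; left; apply/hasP; exists p => /=.
  have szm c : (size (tab 0 f c) <= mdeg m)%N.
    have -> : size (tab 0 f c) = (\sum_(k < N) mult k (tab 0 f c))%N.
      rewrite /mult -(big_mkord xpredT (fun k => count (fun p => p.1 == k) (tab 0 f c))).
      have : all (fun p => p.1 < N)%N (tab 0 f c).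
        apply/allP => p /inm; rewrite -cmE_neq0 /m monE.
        by case: ltnP => // h; rewrite nth_default.
      elim: (tab 0 f c) => [|p t IH] /=; first by rewrite big1.
      move=> /andP[hp /IH ->]; rewrite big_split /= -[LHS]add1n; congr (_ + _)%N.
      rewrite big_mkord (bigD1 (Ordinal hp)) //= eqxx big1 // => i ni; case: eqP => // e.
      by case/eqP: ni; apply: val_inj.
    rewrite (@mdegEn m N); last by move=> k hk; rewrite /m monE nth_default.
    by apply: leq_sum => k _; rewrite -mE (bigD1 c) //= leq_addr.
  pose lift (p : nat * bool) : option (finsupp m * bool) :=
    omap (fun l : finsupp m => (l, p.2)) (insub p.1).
  have liftK t : {in t, forall p, p.1 \in finsupp m} ->
      [seq (val q.1, q.2) | q <- pmap lift t] = t.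
    elim: t => [//|[x i] t IH] h /=.
    have hx : x \in finsupp m := h (x, i) (mem_head _ _).
    rewrite /lift insubT /= IH // => p hp; apply: h; by rewrite inE hp orbT.
  pose B : filling m := [ffun c => insub_bseq (mdeg m) (pmap lift (tab 0 f c))].
  have BE : letters B = tab 0 f.
    apply: funext => c; rewrite /letters ffunE /insub_bseq insubdK.
      by rewrite liftK // => p /inm.
    rewrite -topredE /= size_pmap (leq_trans (count_size _ _)) //.
  have PB : P B.
    rewrite /P BE ht /=; apply/eqP/eqP/cmP => k; by rewrite tableau_xweightE mE.
  exists B; first by rewrite mem_enum.
  apply: (@eq_from_nth _ [ffun=> (ord0, false)]); rewrite ?size_mkseq // => i hi.
  apply/ffunP => c.
  have : [seq entry g c | g <- f] = [seq entry g c | g <- F B].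
    rewrite entF BE -[in RHS]sf -{1}(size_map (fun g => entry g c)) codeK //.
    by rewrite all_map; apply: sub_all hn => g /forallP /(_ c).
  move/(congr1 (fun u => nth (0%N, false) u i)).
  rewrite !(nth_map [ffun=> (ord0, false)]) ?size_mkseq -?sf // /entry.
  case: (nth _ f i c) => u x; case: (nth _ (F B) i c) => v y /= [h ->].
  by congr pair; apply: val_inj.
rewrite -big_filter -(perm_big _ pe) big_map big_enum_cond /=.
by apply: eq_big => B; rewrite ?andbT // => h; rewrite tabF.
Qed.
End Sum.

(** Passes to polynomials, where a product of sums expands over finite functions; as Q is finite, a
    factor agrees with its polynomial only up to degree D, which is enough for the coefficient n. *)
Lemma series_prod_coef (R : comNzRingType) (I Q : finType) (deg : Q -> nat)
    (w : I -> Q -> R) (F : I -> series R) D n : (n <= D)%N ->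
  (forall c i, (i <= D)%N -> F c i = \sum_(q | deg q == i) w c q) ->
  (\prod_c F c) n =
  \sum_(g : {ffun I -> Q} | (\sum_c deg (g c))%N == n) \prod_c w c (g c).
Proof.
move=> hn hF; pose p c : {poly R} := \sum_q (w c q)%:P * 'X^(deg q).
have -> : (\prod_c F c) n = (\prod_c p c)`_n.
  move: n hn; apply: (big_ind2 (fun (f : series R) (r : {poly R}) =>
      forall n, (n <= D)%N -> f n = r`_n)) => [n _|f1 r1 f2 r2 h1 h2 n hn|c _ n hn].
  - by rewrite coef1.
  - rewrite seriesM coefM; apply: eq_bigr => i _.
    have hi : (i <= n)%N by rewrite -ltnS.
    by rewrite h1 ?h2 // ?(leq_trans _ hn) // leq_subr.
  rewrite hF // coef_sum [LHS]big_mkcond; apply: eq_bigr => q _.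
  by rewrite coefCM coefXn eq_sym; case: eqP => _; rewrite ?mulr1 ?mulr0.
rewrite bigA_distr_bigA coef_sum [RHS]big_mkcond; apply: eq_bigr => g _.
rewrite big_split /= -rmorph_prod /= prodrXr coefCM coefXn eq_sym.
by case: eqP => _; rewrite ?mulr1 ?mulr0.
Qed.

Definition geom (R : comNzRingType) (a : R) : series R := fun n => a ^+ n.
Definition svar (R : comNzRingType) : series R := fun n => (n == 1%N)%:R.

(** * The operators of a letter and their generating functions *)

Section Operators.
Variables (C : finType) (Hr Vr : rel C) (R : comNzRingType) (a b : C -> R).

(** This is x/(1 - a x), and [old_weight] is (1 + b x)/(1 - a x). *)
Definition new_weight c : series R := fun n => if n is n'.+1 then a c ^+ n' else 0.
Definition old_weight c : series R :=
  fun n => if n is n'.+1 then a c ^+ n + b c * a c ^+ n' else 1.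

(** Acts backwards, from the set after the insertion to the set before it: words are run on the
    indicator of [setT] and read at [set0]. *)
Definition letter_op n (w : {ffun {set C} -> R}) : {ffun {set C} -> R} :=
  [ffun S => \sum_(S' : {set C}) kernel Hr Vr new_weight old_weight S S' n * w S'].

Lemma sum_fst D (F : 'I_D.+1 * bool -> R) i : (i <= D)%N ->
  \sum_(q : 'I_D.+1 * bool | (q.1 : nat) == i) F q = F (inord i, true) + F (inord i, false).
Proof.
move=> hi; rewrite (bigD1 (inord i, true)) /=; last by rewrite inordK.
congr (_ + _); rewrite (bigD1 (inord i, false)) /=; last by rewrite inordK // eqxx xpair_eqE andbF.
rewrite big1 ?addr0 // => -[k fl] /=.
move=> /andP[/andP[/eqP e]]; rewrite !xpair_eqE -!val_eqE /= inordK // e eqxx.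
by case: fl.
Qed.

Lemma kernel_coef D n S S' : (n <= D)%N ->
  kernel Hr Vr new_weight old_weight S S' n =
  \sum_(g : {ffun C -> 'I_D.+1 * bool} | content g == n) step Hr Vr a b S S' g.
Proof.
move=> hn; rewrite /kernel.
apply: (@series_prod_coef _ _ _ (fun q : 'I_D.+1 * bool => q.1 : nat)
  (fun c q => cell_step a b (c \in S) (c \in S') (blocked Hr Vr S S' c) c (q.1 : nat, q.2)) _ _ _ hn) => c i hi.
rewrite sum_fst //= inordK // /cell_step /local_weight.
case: (c \in S); case: (c \in S') => /=.
- case: blocked; case: i hi => [|i] hi; rewrite ?series1 ?add0r ?addr0 //=.
  by rewrite addrC.
- by rewrite series0 addr0.
- by case: blocked; case: i hi => [|i] hi; rewrite ?series0 ?add0r ?addr0.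
by rewrite series1 andbF andbT add0r.
Qed.

Lemma run_letter_op D s S : all (fun n => n <= D)%N s ->
  run letter_op s [ffun S' => (S' == setT)%:R] S =
  \sum_(f <- all_lists {ffun C -> 'I_D.+1 * bool} (size s) | map (@content C D) f == s)
     run_weight Hr Vr a b S f.
Proof.
elim: s S => [|n s IH] S /=; first by rewrite big_cons big_nil /= ffunE addr0.
move=> /andP[hn hs]; rewrite ffunE [RHS]big_mkcond big_allpairs_dep big_enum /=.
transitivity (\sum_(g : {ffun C -> 'I_D.+1 * bool} | content g == n)
   step Hr Vr a b S (S :|: receivers g) g *
   run letter_op s [ffun S' => (S' == setT)%:R] (S :|: receivers g)).
  under eq_bigr do rewrite (kernel_coef _ _ hn) mulr_suml.
  rewrite exchange_big; apply: eq_bigr => g _.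
  by rewrite (bigD1 (S :|: receivers g)) //= big1 ?addr0 // => S' /step0 ->; rewrite mul0r.
rewrite big_mkcond; apply: eq_bigr => g _.
case: (eqVneq (content g) n) => e; last first.
  by rewrite big1 // => f _; rewrite eqseq_cons (negbTE e).
rewrite IH // mulr_sumr big_mkcond; apply: eq_bigr => f _.
by rewrite eqseq_cons e eqxx.
Qed.

Lemma leq_sumn n s : n \in s -> (n <= sumn s)%N.
Proof.
elim: s => //= k s IH; rewrite inE => /orP[/eqP ->|/IH h]; first exact: leq_addr.
exact: leq_trans h (leq_addl _ _).
Qed.

Lemma tableau_sumE s : tableau_sum Hr Vr a b (mon s) =
  run letter_op s [ffun S => (S == setT)%:R] set0.
Proof.
rewrite (tableau_sum_run _ _ _ _ (leqnn _)) (@run_letter_op (sumn s)) //.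
by apply/allP => n /leq_sumn.
Qed.

Lemma letter_opD n : {morph letter_op n : u v / u + v}.
Proof.
move=> u v; apply/ffunP => S; rewrite !ffunE -big_split; apply: eq_bigr => S' _.
by rewrite !ffunE mulrDr.
Qed.

Lemma kernel_coef0 S S' :
  kernel Hr Vr new_weight old_weight S S' 0%N = (S == S')%:R.
Proof.
rewrite /kernel (big_morph (fun f : series R => f 0%N) (id1 := 1) (op1 := *%R)) => [|f g|//]; last first.
  by rewrite seriesM big_ord1.
have e c : local_weight new_weight old_weight (c \in S) (c \in S')
    (blocked Hr Vr S S' c) c 0%N = ((c \in S) == (c \in S'))%:R.
  by rewrite /local_weight; case: (c \in S); case: (c \in S') => //=; case: blocked.
under eq_bigr do rewrite e.
case: eqP => [->|/eqP neS]; first by rewrite big1 // => c _; rewrite eqxx.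
have [c hc] : exists c, (c \in S) != (c \in S').
  apply/existsP; apply: contraNT neS; rewrite negb_exists => /forallP h.
  by apply/eqP/setP => c; have := h c; rewrite negbK => /eqP.
by rewrite (bigD1 c) //= (negbTE hc) mul0r.
Qed.

Lemma letter_op0 w : letter_op 0 w = w.
Proof.
apply/ffunP => S; rewrite ffunE (bigD1 S) //= kernel_coef0 eqxx mul1r.
rewrite big1 ?addr0 // => S' neS; by rewrite kernel_coef0 eq_sym (negbTE neS) mul0r.
Qed.
End Operators.

Definition ssgn (R : comNzRingType) (f : series R) : series R := fun n => sgn n (f n).

Section SeriesSign.
Variable R : comNzRingType.

Lemma ssgn_add : {morph (@ssgn R) : f g / f + g}.
Proof. by move=> f g; apply: funext => n; rewrite /ssgn !seriesD sgnD. Qed.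

Lemma ssgn1 : ssgn (1 : series R) = 1.
Proof.
by apply: funext => -[|n] //; rewrite /ssgn series1 /= /sgn oppr0 if_same.
Qed.

Lemma ssgnM : {morph (@ssgn R) : f g / f * g}.
Proof.
move=> f g; apply: funext => n; rewrite /ssgn !seriesM.
rewrite (morphD_sum (@sgnD R n)); apply: eq_bigr => i _.
have hi : (i <= n)%N by rewrite -ltnS.
rewrite /sgn oddB //; case: (odd n); case: (odd i); rewrite /= ?mulNr ?mulrN ?opprK //.
Qed.
End SeriesSign.

Section LocalSeries.
Variables (C : finType) (R : comNzRingType) (a b : C -> R).

Lemma smul_lin (u : R) (f : series R) n :
  ((1 - sconst u * svar R) * f) n = f n - (if n is n'.+1 then u * f n' else 0).
Proof.
rewrite mulrBl mul1r seriesD seriesN; congr (_ - _).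
have e : sconst u * svar R = fun k => if k == 1%N then u else 0.
  apply: funext => k; rewrite seriesM big_ord_recl big1 ?addr0 => [|i _]; last by rewrite mul0r.
  by rewrite /= subn0 /svar; case: eqP; rewrite ?mulr1 ?mulr0.
rewrite e seriesM big_ord_recl mul0r add0r; case: n => [|n]; first by rewrite big_ord0.
rewrite big_ord_recl big1 ?addr0 => [|i _]; last by rewrite mul0r.
by rewrite /= /bump /= subSS subn0.
Qed.

Lemma geomV (u : R) : (1 - sconst u * svar R) * geom u = 1.
Proof.
apply: funext => n; rewrite smul_lin series1 /geom; case: n => [|n] /=.
  by rewrite expr0 subr0.
by rewrite exprS subrr.
Qed.

Lemma svar_mul (f : series R) : svar R * f = shift f.
Proof.
apply: funext => -[|n]; rewrite seriesM big_ord_recl mul0r add0r ?big_ord0 //.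
rewrite big_ord_recl big1 ?addr0 => [|i _]; last by rewrite mul0r.
by rewrite /svar /= mul1r subSS subn0.
Qed.

Lemma new_weightE c : new_weight a c = svar R * geom (a c).
Proof. by rewrite svar_mul; apply: funext => -[]. Qed.

Lemma sconstN (u : R) : sconst (- u) = - sconst u.
Proof. by apply: funext => -[|n]; rewrite seriesN //= oppr0. Qed.

Lemma old_weightE c : old_weight a b c = (1 - sconst (- b c) * svar R) * geom (a c).
Proof.
apply: funext => n; rewrite smul_lin; case: n => [|n]; first by rewrite subr0.
by rewrite /geom mulNr opprK.
Qed.

Lemma ssgn_geom (u : R) : ssgn (geom u) = geom (- u).
Proof.
apply: funext => n; rewrite /ssgn /geom /sgn exprNn -signr_odd.
by case: (odd n); rewrite ?expr1 ?expr0 ?mulN1r ?mul1r.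
Qed.

Lemma ssgn_svar : ssgn (svar R) = - svar R.
Proof.
by apply: funext => -[|[|n]]; rewrite seriesN /ssgn /svar /sgn /= ?oppr0 // if_same.
Qed.

Lemma ssgn_sconst (u : R) : ssgn (sconst u) = sconst u.
Proof. by apply: funext => -[|n] //; rewrite /ssgn /sgn /= oppr0 if_same. Qed.

End LocalSeries.

Section Dual.
Variables (C : finType) (Hr Vr : rel C) (R : comNzRingType) (a b : C -> R).
Hypothesis corner : forall N : {set C}, N != set0 -> exists2 c, c \in N &
  (forall c', Hr c c' -> c' \notin N) /\
  (forall d, Vr d c -> d \notin N /\ forall c', Hr d c' -> c' \notin N).

Lemma ssgn_old_weight c :
  ssgn (old_weight a b c) = (1 - sconst (b c) * svar R) * geom (- a c).
Proof.
rewrite old_weightE ssgnM ssgn_geom ssgn_add ssgn1 -mulNr -sconstN opprK.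
by rewrite ssgnM ssgn_sconst ssgn_svar mulrN.
Qed.

(** With -x for x the first family has X = -x/(1 + a x) and G = (1 - b x)/(1 + a x); the second has
    X' = x/(1 - b x) and G' = (1 + a x)/(1 - b x). Hence G G' = 1 and X G' + X' = 0. *)
Lemma letter_op_dual : dual_ops (letter_op Hr Vr a b) (letter_op Vr Hr b a).
Proof.
split; try exact: letter_opD; try exact: letter_op0.
move=> n w; apply/ffunP => S; rewrite sum_ffunE [RHS]ffunE.
pose K1 S S' := kernel Hr Vr (new_weight a) (old_weight a b) S S'.
pose K2 S S' := kernel Vr Hr (new_weight b) (old_weight b a) S S'.
have inv S' : \sum_(T : {set C}) ssgn (K1 S T) * K2 T S' = (S == S')%:R.
  rewrite -(@kernel_inv C Hr Vr (series R) (fun c => ssgn (new_weight a c))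
     (fun c => ssgn (old_weight a b c)) (new_weight b) (old_weight b a)) //.
  - apply: eq_bigr => T _; congr (_ * _).
    rewrite /K1 /kernel (big_morph _ (@ssgnM R) (@ssgn1 R)).
    apply: eq_bigr => c _; rewrite /local_weight.
    have s0 : ssgn 0 = 0 :> series R.
      by apply: funext => k; rewrite /ssgn /sgn oppr0 if_same.
    by case: (c \in S); case: (c \in T); case: (blocked Hr Vr S T c); rewrite ?ssgn1 ?s0.
  - move=> c; rewrite ssgn_old_weight old_weightE mulrACA [geom _ * geom _]mulrC mulrACA.
    by rewrite !geomV mulr1.
  - move=> c; rewrite !new_weightE old_weightE ssgnM ssgn_svar ssgn_geom.
    rewrite mulrA -[_ * (1 - _)]mulrA [geom _ * (1 - _)]mulrC geomV mulr1.
    by rewrite mulNr addNr.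
(* The identity matrix is constant in x, so its coefficient at n + 1 vanishes. *)
transitivity (\sum_(S' : {set C}) ((S == S')%:R : series R) n.+1 * w S'); last first.
  rewrite big1 // => S' _; case: (S == S'); by rewrite /= ?series1 ?series0 mul0r.
under [RHS]eq_bigr do rewrite -inv series_sum mulr_suml.
rewrite [RHS]exchange_big /=.
under [RHS]eq_bigr do under eq_bigr do rewrite seriesM mulr_suml.
under [RHS]eq_bigr do rewrite exchange_big /=.
rewrite [RHS]exchange_big /=; apply: eq_bigr => i _.
transitivity (sgn i (letter_op Hr Vr a b i (letter_op Vr Hr b a (n.+1 - i) w) S)).
  by rewrite /sgn; case: ifP => _ //; rewrite ffunE.
rewrite ffunE (morphD_sum (@sgnD R i)); apply: eq_bigr => T _.
rewrite ffunE mulr_sumr (morphD_sum (@sgnD R i)); apply: eq_bigr => S' _.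
by rewrite /ssgn /sgn; case: ifP => _ //; rewrite mulrA // !mulNr.
Qed.
End Dual.

(** * Commutation of the transfer kernels *)

Section RowSum.
Variables (E : comNzRingType) (al p q : nat -> E) (be x y : E).
Hypothesis pE : forall j, p j * (1 - al j * x) = 1.
Hypothesis qE : forall j, q j * (1 - al j * y) = 1.
Variables (a : nat) (lx ly : E).
(* Holds for [lx = ly = 1] and for [lx = (1 + be x) p_j, ly = (1 + be y) q_j]. *)
Hypothesis lE : (y - x) * lx * ly = ly * y * (1 + be * x) - lx * x * (1 + be * y).

(** The index k is the row length after the first letter. For k > a the last cell was just filled
    and may also take the second letter, with weight (1 + be y) q_(k-1); at k = a a boundary factor
    stands instead. *)
Definition row_factor (w : E) k := if k == a then w else (1 + be * y) * q k.-1.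

Definition row_sum b := \sum_(a <= k < b.+1)
  (\prod_(a <= j < k) (x * p j)) * (\prod_(k <= j < b) (y * q j)) * row_factor ly k.

Lemma row_sumS b : (a <= b)%N -> row_sum b.+1 =
  row_sum b * (y * q b) + (\prod_(a <= j < b.+1) (x * p j)) * ((1 + be * y) * q b).
Proof.
move=> h; rewrite /row_sum big_nat_recr /=; last exact: leqW.
rewrite [\prod_(b.+1 <= _ < b.+1) _]big_geq // mulr1 /row_factor [b.+1 == a]eqn_leq [(_ <= a)%N]leqNgt ltnS h /=; congr (_ + _).
rewrite mulr_suml big_nat_cond [RHS]big_nat_cond; apply: eq_bigr => k /andP[/andP[_ hk] _].
by rewrite big_nat_recr //=; move: (\prod_(_ <= _ < k) _) (\prod_(k <= _ < b) _) => u v; ring.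
Qed.

Lemma row_sum0 : row_sum a = ly.
Proof. by rewrite /row_sum big_nat1 !big_geq // !mul1r /row_factor eqxx. Qed.

Lemma diff_pq j : y * q j - x * p j = p j * q j * (y - x).
Proof.
have -> : y * q j - x * p j =
  y * q j * (p j * (1 - al j * x)) - x * p j * (q j * (1 - al j * y)).
  by rewrite pE qE !mulr1.
by ring.
Qed.

(** By [diff_pq], p_j q_j (y - x) is the difference of y q_j and x p_j, so the terms telescope. *)
Lemma row_sum_closed b : (a <= b)%N -> (y - x) * (lx * row_sum b) =
  (\prod_(a <= j < b) (y * q j)) * (ly * y * (1 + be * x)) -
  (\prod_(a <= j < b) (x * p j)) * (lx * x * (1 + be * y)).
Proof.
elim: b => [|b IH]; first by rewrite leqn0 => /eqP e; rewrite -e row_sum0 !big_geq // !mul1r -lE mulrA.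
rewrite leq_eqVlt => /orP[/eqP <-|]; first by rewrite row_sum0 !big_geq // !mul1r -lE mulrA.
rewrite ltnS => h; rewrite row_sumS // !big_nat_recr //=.
move: (IH h); set P := \prod_(a <= j < b) (y * q j); set Q := \prod_(a <= j < b) (x * p j).
move: (row_sum b) => s hs.
have -> : (y - x) * (lx * (s * (y * q b) + Q * (x * p b) * ((1 + be * y) * q b))) =
  (y - x) * (lx * s) * (y * q b) + Q * x * lx * (1 + be * y) * (p b * q b * (y - x)).
  by ring.
by rewrite hs -diff_pq; ring.
Qed.
End RowSum.

Section RowSymmetry.
Variables (E : comNzRingType) (al p q : nat -> E) (be x y : E).
Hypothesis pE : forall j, p j * (1 - al j * x) = 1.
Hypothesis qE : forall j, q j * (1 - al j * y) = 1.
Variables (a : nat) (lx ly : E).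
Hypothesis lE : (y - x) * lx * ly = ly * y * (1 + be * x) - lx * x * (1 + be * y).

(** In the induction step the difference of the two sides contains the sum only through its product
    with p_b q_b (y - x), and there the closed form applies without dividing by y - x. *)
Lemma row_sum_sym b : (a <= b)%N ->
  lx * row_sum p q be x y a ly b = ly * row_sum q p be y x a lx b.
Proof.
elim: b => [|b IH]; first by rewrite leqn0 => /eqP <-; rewrite !row_sum0 mulrC.
rewrite leq_eqVlt => /orP[/eqP <-|]; first by rewrite !row_sum0 mulrC.
rewrite ltnS => h; rewrite !row_sumS // !mulrDr !mulrA -IH // !big_nat_recr //=.
have := row_sum_closed pE qE lE h.
set P := \prod_(a <= j < b) (y * q j); set Q := \prod_(a <= j < b) (x * p j).
move: (row_sum _ _ _ _ _ _ _ _) => s hs; apply/eqP; rewrite -subr_eq0; apply/eqP.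
have -> : lx * s * y * q b + lx * (Q * (x * p b)) * (1 + be * y) * q b -
   (lx * s * x * p b + ly * (P * (y * q b)) * (1 + be * x) * p b) =
   (lx * s) * (y * q b - x * p b) + p b * q b * (lx * Q * x * (1 + be * y) -
     ly * P * y * (1 + be * x)) by ring.
rewrite (diff_pq pE qE) -[_ * s * (_ * (y - x))]mulrCA [lx * s * _]mulrC hs; ring.
Qed.

(* [rx], [ry] satisfy the hypothesis when they are [1] or [(1 + be' x) p_b],
   [(1 + be' y) q_b]. *)
Lemma row_sum_sym_last b rx ry : (a <= b)%N ->
  y * q b * rx - x * p b * ry = p b * q b * (y - x) ->
  lx * (row_sum p q be x y a ly b * (y * q b) * rx +
    (\prod_(a <= j < b.+1) (x * p j)) * ((1 + be * y) * q b)) =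
  ly * (row_sum q p be y x a lx b * (x * p b) * ry +
    (\prod_(a <= j < b.+1) (y * q j)) * ((1 + be * x) * p b)).
Proof.
move=> h hr; rewrite !mulrDr !mulrA -row_sum_sym // !big_nat_recr //=.
have := row_sum_closed pE qE lE h.
set P := \prod_(a <= j < b) (y * q j); set Q := \prod_(a <= j < b) (x * p j).
move: (row_sum _ _ _ _ _ _ _ _) => s hs; apply/eqP; rewrite -subr_eq0; apply/eqP.
have -> : lx * s * y * q b * rx + lx * (Q * (x * p b)) * (1 + be * y) * q b -
   (lx * s * x * p b * ry + ly * (P * (y * q b)) * (1 + be * x) * p b) =
   (lx * s) * (y * q b * rx - x * p b * ry) + p b * q b * (lx * Q * x * (1 + be * y) -
     ly * P * y * (1 + be * x)) by ring.
rewrite hr mulrCA [lx * s * _]mulrC hs; ring.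
Qed.
End RowSymmetry.

Definition right_of la mu (c c' : skew_cell la mu) :=
  (cell_row c' == cell_row c) && (cell_col c' == (cell_col c).+1).
Definition below la mu (c c' : skew_cell la mu) :=
  (cell_row c' == (cell_row c).+1) && (cell_col c' == cell_col c).

(** * Order ideals of a skew diagram and their row profiles *)

Section Shape.
Variables la mu : seq nat.
Hypotheses (hla : is_partition la) (hmu : is_partition mu) (hsub : partition_sub mu la).

Local Notation L := (nth 0%N la).
Local Notation M := (nth 0%N mu).
Local Notation r := (size la).
Local Notation w := (head 0%N la).
Local Notation C := (skew_cell la mu).

Lemma part_anti nu : is_partition nu -> forall i j, (i <= j)%N -> (nth 0 nu j <= nth 0 nu i)%N.
Proof.
move=> /andP[h _] i j hij; case: (ltnP j (size nu)) => hj; last by rewrite nth_default.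
apply: (sorted_leq_nth (leT := geq)) => //; rewrite ?inE //.
- by move=> x y z; rewrite /geq /= => h1 h2; apply: leq_trans h2 h1.
- by move=> x; apply: leqnn.
exact: leq_ltn_trans hj.
Qed.

Lemma L_anti i : (L i.+1 <= L i)%N. Proof. exact: part_anti. Qed.
Lemma M_anti i : (M i.+1 <= M i)%N. Proof. exact: part_anti. Qed.
Lemma L_le i : (L i <= w)%N. Proof. by rewrite -nth0; apply: part_anti. Qed.
Lemma L_lt i j : (j < L i)%N -> (i < r)%N.
Proof. by case: (ltnP i r) => // h; rewrite nth_default. Qed.

Lemma cell_bounds (c : C) : (M (cell_row c) <= cell_col c < L (cell_row c))%N.
Proof. exact: (valP c). Qed.

Lemma cellP i j : (M i <= j < L i)%N -> exists c : C, cell_row c = i /\ cell_col c = j.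
Proof.
move=> h; have /andP[_ hj] := h; have hi := L_lt hj; have hw := leq_trans hj (L_le i).
by exists (exist (fun c : 'I_r * 'I_w => in_skew la mu c.1 c.2) (Ordinal hi, Ordinal hw) h).
Qed.

Lemma cell_inj (c c' : C) : cell_row c = cell_row c' -> cell_col c = cell_col c' -> c = c'.
Proof.
case: c c' => -[i j] h [[i' j'] h']; rewrite /cell_row /cell_col /= => e1 e2.
by apply: val_inj => /=; congr pair; apply: val_inj.
Qed.

Lemma prod_cells (E : comNzRingType) (F : nat -> nat -> E) :
  \prod_(c : C) F (cell_row c) (cell_col c) = \prod_(i < r) \prod_(M i <= j < L i) F i j.
Proof.
transitivity (\prod_(p : 'I_r * 'I_w | in_skew la mu p.1 p.2) F p.1 p.2).
  rewrite (reindex_omap (val : C -> _) insub) => [|p hp]; last by rewrite insubT.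
  by apply: eq_bigl => c; rewrite (valP c) valK eqxx.
rewrite -(pair_big_dep xpredT (fun i j => in_skew la mu (i : 'I_r) (j : 'I_w)) (fun i j => F i j)) /=.
apply: eq_bigr => i _; rewrite -(big_mkord (in_skew la mu i) (F i)).
rewrite (big_cat_nat (n := M i)) //=; last exact: leq_trans (hsub i) (L_le i).
rewrite big_nat_cond big1 ?mul1r; last first.
  by move=> j /andP[/andP[_ h1] /andP[h2 _]]; rewrite leqNgt h1 in h2.
rewrite (big_cat_nat (n := L i)) //=; last exact: L_le.
rewrite [X in _ * X]big_nat_cond [X in _ * X]big1 ?mulr1; last first.
  by move=> j /andP[/andP[h1 _] /andP[_ h2]]; rewrite ltnNge h1 in h2.
rewrite big_nat_cond [RHS]big_nat_cond; apply: eq_bigl => j; rewrite /in_skew andbT.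
by case: (_ <= _ < _)%N.
Qed.

Definition ideal (K : {set C}) := forall c c', right_of c c' || below c c' -> c' \in K -> c \in K.
Definition cells_below (v : nat -> nat) : {set C} := [set c | (cell_col c < v (cell_row c))%N].
(** For an ideal, the first free column of row i; the maximum with M_i gives the value for an empty
    row. *)
Definition profile (K : {set C}) i : nat :=
  maxn (M i) (\max_(c in K | cell_row c == i) (cell_col c).+1).
Definition is_profile (v : nat -> nat) :=
  (forall i, M i <= v i <= L i)%N /\ (forall i, v i.+1 <= v i)%N.

Lemma ideal_row (K : {set C}) c c1 : ideal K -> c1 \in K ->
  cell_row c = cell_row c1 -> (cell_col c <= cell_col c1)%N -> c \in K.
Proof.
move=> hK h1 hr hc; have [n hn] : exists n, (cell_col c1 - cell_col c = n)%N by eexists.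
elim: n c hr hc hn => [|n IH] c hr hc hn.
  by rewrite (@cell_inj c c1) //; lia.
have [|c2 [e1 e2]] := @cellP (cell_row c) (cell_col c).+1.
  have := cell_bounds c1; have := cell_bounds c; rewrite -hr; lia.
apply: (hK c c2); first by rewrite /right_of e1 e2 !eqxx.
by apply: IH; rewrite ?e1 ?e2 //; lia.
Qed.

Lemma profile_mem (K : {set C}) c : ideal K -> (c \in K) = (cell_col c < profile K (cell_row c))%N.
Proof.
move=> hK; have /andP[hM _] := cell_bounds c; apply/idP/idP => [h|].
  rewrite leq_max; apply/orP; right.
  by apply: (leq_bigmax_cond (F := fun c : C => (cell_col c).+1) c); rewrite h eqxx.
rewrite leq_max ltnNge hM /=.
case: (boolP [exists c1 in K, cell_row c1 == cell_row c]) => [/existsP[c0 h0]|hn].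
  rewrite (bigmax_eq_arg c0) //; case: arg_maxnP => // c1 /andP[h1 /eqP e] _.
  rewrite ltnS => hle; exact: (ideal_row hK h1).
rewrite big_pred0 // => c1; apply: contraNF hn => h; by apply/existsP; exists c1.
Qed.

Lemma cells_below_profile (K : {set C}) : ideal K -> cells_below (profile K) = K.
Proof. by move=> h; apply/setP => c; rewrite inE -profile_mem. Qed.

Lemma profile_cells_below v i : is_profile v -> profile (cells_below v) i = v i.
Proof.
move=> [h _]; have /andP[h1 h2] := h i; apply/eqP; rewrite eqn_leq geq_max h1 /=.
apply/andP; split.
  by apply/bigmax_leqP => c /andP[]; rewrite inE => + /eqP <-.
move: h1; rewrite leq_eqVlt => /orP[/eqP <-|h1]; first exact: leq_maxl.
have [|c [e1 e2]] := @cellP i (v i).-1; first by lia.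
rewrite leq_max; apply/orP; right.
have -> : v i = (cell_col c).+1 by lia.
by apply: (leq_bigmax_cond (F := fun c : C => (cell_col c).+1) c); rewrite inE e1 e2 eqxx andbT; lia.
Qed.

Lemma profileP (K : {set C}) : ideal K -> is_profile (profile K).
Proof.
move=> hK; split=> i.
  rewrite leq_maxl /= geq_max hsub /=; apply/bigmax_leqP => c /andP[_ /eqP <-].
  by have /andP[] := cell_bounds c.
rewrite {1}/profile geq_max; apply/andP; split.
  by apply: leq_trans (M_anti i) _; apply: leq_maxl.
apply/bigmax_leqP => c /andP[hc /eqP e]; have := cell_bounds c; rewrite e => /andP[_ hL].
case: (leqP (M i) (cell_col c)) => hM; last by rewrite leq_max hM.
have [|c' [e1 e2]] := @cellP i (cell_col c); first by rewrite hM (leq_trans hL) ?L_anti.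
have hc' : c' \in K by apply: (hK c' c) => //; rewrite /below e e1 e2 !eqxx orbT.
by move: hc'; rewrite profile_mem // e1 e2.
Qed.

Lemma ideal_cells_below v : is_profile v -> ideal (cells_below v).
Proof.
move=> [_ h] c c'; rewrite /right_of /below !inE => /orP[] /andP[/eqP -> /eqP ->].
  exact: ltnW.
by move=> h1; apply: leq_trans h1 (h _).
Qed.

Lemma blocked_profile s t c : is_profile s -> is_profile t ->
  blocked (@right_of la mu) (@below la mu) (cells_below s) (cells_below t) c =
  ((cell_col c).+1 < s (cell_row c))%N || (cell_col c < t (cell_row c).+1)%N.
Proof.
move=> [hs _] [ht _]; have /andP[hM hL] := cell_bounds c.
apply/existsP/orP => [[c' /orP[]]|[h|h]].
- by rewrite inE => /andP[/andP[/eqP -> /eqP ->]]; left.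
- by rewrite inE => /andP[/andP[/eqP -> /eqP ->]]; right.
- have [|c' [e1 e2]] := @cellP (cell_row c) (cell_col c).+1; first by have := hs (cell_row c); lia.
  by exists c'; rewrite !inE /right_of e1 e2 !eqxx h.
have [|c' [e1 e2]] := @cellP (cell_row c).+1 (cell_col c).
  by have := ht (cell_row c).+1; have := M_anti (cell_row c); lia.
by exists c'; rewrite !inE /below e1 e2 !eqxx h orbT.
Qed.

Section Weights.
Variables (E : comNzRingType) (x : E) (p be : nat -> E).

Definition corner_weight i j : E := (1 + be i * x) * p j.
(** Only the last old cell of a row can take the letter, the others having a filled right neighbour.
    The weight is 0 when the first new cell, in column s_i, lies above a filled one. *)
Definition row_kernel (s t : nat -> nat) i : E :=
  if (s i < t i)%N && (s i < t i.+1)%N then 0 else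
  (if (M i < s i)%N && (t i.+1 < s i)%N then corner_weight i (s i).-1 else 1) *
  \prod_(s i <= j < t i) (x * p j).

Definition kernel_shape := kernel (@right_of la mu) (@below la mu)
  (fun c => x * p (cell_col c)) (fun c => corner_weight (cell_row c) (cell_col c)).

Lemma kernel_profile s t : is_profile s -> is_profile t -> (forall i, s i <= t i)%N ->
  kernel_shape (cells_below s) (cells_below t) = \prod_(i < r) row_kernel s t i.
Proof.
move=> ps pt st; rewrite /kernel_shape /kernel.
pose F i j := local_weight (fun _ : unit => x * p j)
   (fun _ => corner_weight i j)
   (j < s i)%N (j < t i)%N ((j.+1 < s i)%N || (j < t i.+1)%N) tt.
transitivity (\prod_(c : C) F (cell_row c) (cell_col c)).
  by apply: eq_bigr => c _; rewrite blocked_profile // !inE.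
rewrite prod_cells; apply: eq_bigr => i _.
have [/(_ i) /andP[h1 h2] _] := ps; have [/(_ i) /andP[h3 h4] _] := pt.
rewrite (big_cat_nat (n := s i)) //= (big_cat_nat (n := t i) (m := s i)) //=.
rewrite [X in _ * (_ * X)]big_nat_cond [X in _ * (_ * X)]big1 ?mulr1; last first.
  move=> j /andP[/andP[h5 _] _]; rewrite /F /local_weight.
  by rewrite !ltnNge h5 (leq_trans _ h5).
(* If the first new cell is open, then t_(i+1) is at most s_i and all later ones are open too. *)
have e2 : \prod_(s i <= j < t i) F i j =
    if (s i < t i)%N && (s i < t i.+1)%N then 0 else \prod_(s i <= j < t i) (x * p j).
  case: ifP => [/andP[h5 h6]|h5].
    rewrite big_ltn // {1}/F /local_weight ltnn h5 h6 orbT.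
    by rewrite mul0r.
  rewrite big_nat_cond [RHS]big_nat_cond; apply: eq_bigr => j /andP[/andP[h6 h7] _].
  have -> : F i j = local_weight (fun _ : unit => x * p j)
     (fun _ => corner_weight i j) false true false tt; last by [].
  rewrite /F h7; have -> : (j < s i)%N = false by lia.
  have -> // : (j.+1 < s i)%N || (j < t i.+1)%N = false.
  by move: h5; rewrite (leq_ltn_trans h6 h7) /=; lia.
rewrite e2 /row_kernel; case: ifP => _; first by rewrite mulr0.
congr (_ * _); case: (ltnP (M i) (s i)) => h5 /=; last by rewrite big_geq.
rewrite -(prednK (leq_ltn_trans (leq0n _) h5)) big_nat_recr /=; last by lia.
rewrite big_nat_cond big1 ?mul1r => [|j /andP[/andP[h6 h7] _]]; last first.
  rewrite /F /local_weight.
  have -> : (j < s i)%N by lia.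
  have -> : (j < t i)%N by have := st i; lia.
  by have -> : (j.+1 < s i)%N by lia.
rewrite /F /local_weight.
have -> : ((s i).-1 < s i)%N by lia.
have -> : ((s i).-1 < t i)%N by have := st i; lia.
have -> : ((s i).-1.+1 < s i)%N = false by lia.
rewrite prednK /=; last by lia.
by case: ltnP; case: ltnP => //; lia.
Qed.
End Weights.
End Shape.

(** * Two insertions, row by row *)

Section TwoLetters.
Variables (E : comNzRingType) (M s t : nat -> nat) (r w : nat) (al be : nat -> E).
Hypotheses (Ms : forall i, (M i <= s i)%N) (st : forall i, (s i <= t i)%N).
Hypotheses (sr : s r = 0%N) (tr : t r.+1 = 0%N) (tw : forall i, (t i <= w)%N).

(** An intermediate length n of row i is at least t_(i+1), so these cells must take the first
    letter. With i - 1 for i they are the cells of row i that must take the second, as n is at most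
    s_(i-1). *)
Definition left_prod (x : E) (p : nat -> E) i := \prod_(s i <= j < t i.+1) (x * p j).

(** If row i + 1 of T ends before the old corner of row i, that corner is open to the first letter
    for all intermediate lengths, and to the second when the first does not extend row i. *)
Definition left_corner (x : E) (p : nat -> E) i :=
  if (t i.+1 < s i)%N && (M i < s i)%N then corner_weight x p be i (s i).-1 else 1.

Definition low i := maxn (s i) (t i.+1).
Definition high i := if i is i'.+1 then minn (t i) (s i') else t i.

(** If t_i < s_(i-1), the corner of row i - 1 is always open and counted by [left_corner]; otherwise
    [high i] is s_(i-1), and it is open exactly when n < [high i]. *)
Definition right_corner (x : E) (p : nat -> E) i :=
  if i is i'.+1 then
    if (M i' < s i')%N && (s i' <= t i)%N then corner_weight x p be i' (high i).-1 else 1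
  else 1.

(* Contribution of row [i] when [n] is its length between the two insertions.
   The corner of row [i - 1] is accounted for here, because whether it may receive
   the first letter depends on [n] only. *)
Definition row_weight (x : E) (p : nat -> E) (y : E) (q : nat -> E) i n : E :=
  if [&& s i <= n, n <= t i, t i.+1 <= n & (if i is i'.+1 then n <= s i' else true)]%N then
    (\prod_(s i <= j < n) (x * p j)) * (\prod_(n <= j < t i) (y * q j)) *
    (if (M i < n)%N && (t i.+1 < n)%N then corner_weight y q be i n.-1 else 1) *
    (if i is i'.+1 then
       if (M i' < s i')%N && (n < s i')%N then corner_weight x p be i' (s i').-1 else 1
     else 1)
  else 0.

Definition core (x : E) (p : nat -> E) (y : E) (q : nat -> E) i : E :=
  \sum_(low i <= n < (high i).+1)
    (\prod_(low i <= j < n) (x * p j)) * (\prod_(n <= j < high i) (y * q j)) *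
    row_factor q (be i) y (low i) (left_corner y q i) n *
    (if (n < high i)%N then right_corner x p i else 1).

(** Forced cells and a corner that is open in any case do not depend on n and leave the sum. *)
Lemma row_weight_sum x p y q i : \sum_(n < w.+1) row_weight x p y q i n =
  left_prod x p i *
  (if i is i'.+1 then left_prod y q i' * left_corner x p i' else 1) * core x p y q i.
Proof.
have hle : (high i <= t i)%N by rewrite /high; case: (i) => // i'; apply: geq_minl.
rewrite -(big_mkord xpredT (row_weight x p y q i)).
transitivity (\sum_(0 <= n < w.+1 | (low i <= n < (high i).+1)%N) row_weight x p y q i n).
  rewrite [RHS]big_mkcond; apply: eq_bigr => n _; case: ifP => // h.
  rewrite /row_weight; case: ifP => // /and4P[h1 h2 h3 h4].
  move: h; rewrite /low geq_max h1 h3 ltnS /high /=.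
  by case: (i) h2 h4 => [|i'] h2 h4; rewrite ?leq_min h2 ?h4.
rewrite -big_nat_widen; last by rewrite ltnS (leq_trans hle).
transitivity (\sum_(low i <= n < (high i).+1) row_weight x p y q i n).
  by rewrite [RHS](big_nat_widenl _ 0).
rewrite /core mulr_sumr big_nat_cond [RHS]big_nat_cond.
apply: eq_bigr => n; rewrite andbT ltnS => /andP[h1 h2].
have [h3 h4] : (s i <= n)%N /\ (t i.+1 <= n)%N by move: h1; rewrite geq_max => /andP.
have -> : row_weight x p y q i n =
    (\prod_(s i <= j < n) (x * p j)) * (\prod_(n <= j < t i) (y * q j)) *
    (if (M i < n)%N && (t i.+1 < n)%N then corner_weight y q be i n.-1 else 1) *
    (if i is i'.+1 then
       if (M i' < s i')%N && (n < s i')%N then corner_weight x p be i' (s i').-1 else 1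
     else 1).
  rewrite /row_weight h3 h4 (leq_trans h2 hle) /=.
  by case: (i) h2 => //= i'; rewrite leq_min => /andP[_ ->].
have eX : \prod_(s i <= j < n) (x * p j) =
    left_prod x p i * \prod_(low i <= j < n) (x * p j).
  rewrite (big_cat_nat (n := low i)) ?leq_maxl //=; congr (_ * _).
  rewrite /left_prod /low; case: (leqP (s i) (t i.+1)) => // h.
  by rewrite !big_geq // ltnW.
have eY : \prod_(n <= j < t i) (y * q j) =
    (if i is i'.+1 then left_prod y q i' else 1) * \prod_(n <= j < high i) (y * q j).
  rewrite (big_cat_nat (n := high i)) //= mulrC; congr (_ * _).
  rewrite /left_prod /high; case: (i) => [|i']; first by rewrite big_geq.
  by case: (leqP (t i'.+1) (s i')) => // h; rewrite !big_geq.
have eG : (if (M i < n)%N && (t i.+1 < n)%N then corner_weight y q be i n.-1 else 1) =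
    row_factor q (be i) y (low i) (left_corner y q i) n.
  rewrite /row_factor /left_corner /low; case: eqP => [e|/eqP ne].
    rewrite andbC e; case: (leqP (s i) (t i.+1)) => h5; first by rewrite ltnn.
    by rewrite h5.
  have h6 : (low i < n)%N by rewrite ltn_neqAle eq_sym ne.
  move: h6; rewrite /low gtn_max => /andP[h6 h7].
  by rewrite h7 (leq_ltn_trans (Ms i) h6).
have eA : (if i is i'.+1 then
       if (M i' < s i')%N && (n < s i')%N then corner_weight x p be i' (s i').-1 else 1
     else 1) = (if i is i'.+1 then left_corner x p i' else 1) *
    (if (n < high i)%N then right_corner x p i else 1).
  rewrite /left_corner /right_corner; case: (i) h2 => [|i'] h2; first by rewrite if_same mulr1.
  move: h2; rewrite /high leq_min => /andP[h5 h6].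
  case: (M i' < s i')%N; rewrite ?andbF ?andbT /= ?if_same ?mulr1 //.
  case: (leqP (s i') (t i'.+1)) => h7; rewrite ?mul1r ?if_same ?mulr1 ?(leq_ltn_trans h5 h7) //.
rewrite eX eY eG eA; case: (i) => [|i']; first by rewrite !mulr1 !mul1r !mulrA.
move: (\prod_(low _ <= _ < _) _) (\prod_(n <= _ < _) _) (row_factor _ _ _ _ _ _) => u v z.
move: (left_prod _ _ _) (left_prod _ _ _) (left_corner _ _ _) (if _ then _ else _) => a b c d.
by ring.
Qed.

Section Sym.
Variables (x y : E) (p q : nat -> E).
Hypothesis pE : forall j, p j * (1 - al j * x) = 1.
Hypothesis qE : forall j, q j * (1 - al j * y) = 1.

Lemma left_corner_eq i : let lx := left_corner x p i in let ly := left_corner y q i in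
  (y - x) * lx * ly = ly * y * (1 + be i * x) - lx * x * (1 + be i * y).
Proof.
rewrite /left_corner /corner_weight /=; case: ifP => _; last by ring.
move: (_.-1) => j; have e := diff_pq pE qE j.
transitivity ((1 + be i * x) * (1 + be i * y) * (p j * q j * (y - x))); first by ring.
by rewrite -e; ring.
Qed.

(** The term n = [high i] is split off because it lacks [right_corner]; together with the remaining
    [row_sum] it forms one side of [row_sum_sym_last]. *)
Lemma core_sym i : left_corner x p i * core x p y q i =
  left_corner y q i * core y q x p i.
Proof.
have lE := left_corner_eq i.
case: (ltnP (high i) (low i)) => [h|]; first by rewrite /core !big_geq // !mulr0.
rewrite leq_eqVlt => /orP[/eqP e|h].
  by rewrite /core -e !big_nat1 !big_geq // ltnn /row_factor eqxx !mul1r !mulr1 mulrC.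
have eb : high i = (high i).-1.+1 by rewrite prednK // (leq_ltn_trans _ h).
have hb : (low i <= (high i).-1)%N by rewrite -ltnS -eb.
have coreE (x' y' : E) p' q' : core x' p' y' q' i =
    row_sum p' q' (be i) x' y' (low i) (left_corner y' q' i) (high i).-1 *
      (y' * q' (high i).-1) * right_corner x' p' i +
    (\prod_(low i <= j < (high i).-1.+1) (x' * p' j)) * ((1 + be i * y') * q' (high i).-1).
  rewrite /core big_nat_recr /=; last exact: ltnW.
  rewrite ltnn mulr1 [\prod_(high i <= _ < _) _]big_geq // mulr1; congr (_ + _); last first.
    by rewrite -eb /row_factor eqn_leq leqNgt h.
  rewrite /row_sum !mulr_suml -eb big_nat_cond [RHS]big_nat_cond.
  apply: eq_bigr => n /andP[/andP[h1 h2] _]; rewrite h2; congr (_ * _).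
  have -> : \prod_(n <= j < high i) (y' * q' j) =
      \prod_(n <= j < (high i).-1) (y' * q' j) * (y' * q' (high i).-1).
    by rewrite {1}eb big_nat_recr //= -ltnS -eb.
  by move: (\prod_(_ <= _ < n) _) (\prod_(n <= _ < _) _) (row_factor _ _ _ _ _ _) => u v z; ring.
rewrite !coreE; apply: (row_sum_sym_last pE qE lE) => //.
rewrite /right_corner; case: (i) => [|i']; first by rewrite !mulr1 (diff_pq pE qE).
case: ifP => _; last by rewrite !mulr1 (diff_pq pE qE).
rewrite /corner_weight; move: (_.-1) => j; by ring.
Qed.

(** The sum for row i releases the factor [left_corner] of row i - 1; shifting the product by one
    row joins it to the [core] of its own row, where [core_sym] applies. At row r these factors are
    1. *)
Lemma prod_row_weight_sym :
  \prod_(i < r.+1) \sum_(n < w.+1) row_weight x p y q i n =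
  \prod_(i < r.+1) \sum_(n < w.+1) row_weight y q x p i n.
Proof.
have gen (x' y' : E) p' q' :
    \prod_(i < r.+1) \sum_(n < w.+1) row_weight x' p' y' q' i n =
    (\prod_(i < r.+1) left_prod x' p' i) * (\prod_(i < r.+1) left_prod y' q' i) *
    \prod_(i < r.+1) (left_corner x' p' i * core x' p' y' q' i).
  have e : \prod_(i < r.+1)
      (if i : nat is i'.+1 then left_prod y' q' i' * left_corner x' p' i' else 1) =
      (\prod_(i < r.+1) left_prod y' q' i) * \prod_(i < r.+1) left_corner x' p' i.
    rewrite big_ord_recl mul1r [X in _ = X * _]big_ord_recr [X in _ = _ * X]big_ord_recr /=.
    have -> : left_prod y' q' r = 1 by rewrite /left_prod sr tr big_geq.
    have -> : left_corner x' p' r = 1 by rewrite /left_corner sr.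
    by rewrite !mulr1 -big_split.
  under eq_bigr do rewrite row_weight_sum.
  by rewrite !big_split /= e -!mulrA.
rewrite !gen; congr (_ * _); first exact: mulrC.
by apply: eq_bigr => i _; apply: core_sym.
Qed.
End Sym.
End TwoLetters.

Section TwoStep.
Variables la mu : seq nat.
Hypotheses (hla : is_partition la) (hmu : is_partition mu) (hsub : partition_sub mu la).
Local Notation L := (nth 0%N la).
Local Notation M := (nth 0%N mu).
Local Notation r := (size la).
Local Notation w := (head 0%N la).
Local Notation C := (skew_cell la mu).
Variable E : comNzRingType.
Implicit Types (S T K : {set C}).

Lemma kernel_not_sub (x : E) p be S T : ~~ (S \subset T) ->
  @kernel_shape la mu E x p be S T = 0.
Proof.
move=> /subsetPn [c cS cT]; rewrite /kernel_shape /kernel (bigD1 c) //=.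
by rewrite {1}/local_weight cS (negbTE cT) mul0r.
Qed.

(** A cell c missing from S before a neighbour c' in S belongs to T, so it would be filled while
    blocked by c'. *)
Lemma kernel_not_ideal (x : E) p be S T : ideal T -> ~ ideal S ->
  @kernel_shape la mu E x p be S T = 0.
Proof.
move=> hT hS; case: (boolP (S \subset T)) => [/subsetP sub|]; last exact: kernel_not_sub.
apply: contrapT => hk; apply: hS => c c' hcc' c'S.
case: (boolP (c \in S)) => // cS; case: hk.
have cT : c \in T by apply: (hT c c') => //; apply: sub.
rewrite /kernel_shape /kernel (bigD1 c) //= {1}/local_weight (negbTE cS) cT.
suff -> : blocked (@right_of la mu) (@below la mu) S T c by rewrite mul0r.
by apply/existsP; exists c'; case/orP: hcc' => -> //=; rewrite ?c'S ?(sub c') ?orbT.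
Qed.

Lemma profile_mono S T i : S \subset T -> (profile S i <= profile T i)%N.
Proof.
move=> /subsetP h; rewrite /profile geq_max leq_maxl /=; apply/bigmax_leqP => c /andP[cS e].
rewrite leq_max; apply/orP; right.
by apply: (leq_bigmax_cond (F := fun c : C => (cell_col c).+1) c); rewrite h.
Qed.

Lemma cells_below_mono v v' : (forall i, v i <= v' i)%N ->
  cells_below la mu v \subset cells_below la mu v'.
Proof. by move=> h; apply/subsetP => c; rewrite !inE => hc; apply: leq_trans hc (h _). Qed.

(** Row r is empty but keeps an entry, since its [row_weight] carries the corner of row r - 1. *)
Definition extend (k : {ffun 'I_r.+1 -> 'I_w.+1}) : nat -> nat :=
  fun i => if insub i is Some i' then k i' else 0%N.

Lemma extendE k (i : 'I_r.+1) : extend k i = k i.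
Proof. by rewrite /extend valK. Qed.

Lemma extend_out k i : (r < i)%N -> extend k i = 0%N.
Proof. by move=> h; rewrite /extend insubF // ltnS leqNgt h. Qed.

Lemma L0 i : (r <= i)%N -> L i = 0%N.
Proof. exact: nth_default. Qed.

(** Middle ideals correspond to profiles n_i with max(s_i, t_(i+1)) <= n_i <= min(t_i, s_(i-1)).
    These bounds concern each row separately, so the sum over K factors. *)
Lemma two_letter_kernel (x : E) p y q be S T : ideal S -> ideal T -> S \subset T ->
  \sum_(K : {set C}) @kernel_shape la mu E x p be S K * @kernel_shape la mu E y q be K T =
  \prod_(i < r.+1) \sum_(n < w.+1) row_weight M (profile S) (profile T) be x p y q i n.
Proof.
move=> iS iT sST; set s := profile S; set t := profile T.
have ps : is_profile la mu s := profileP hla hmu hsub iS.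
have pt : is_profile la mu t := profileP hla hmu hsub iT.
have st i : (s i <= t i)%N by apply: profile_mono.
have [bs ds] := ps; have [bt dt] := pt.
have t0 i : (r <= i)%N -> t i = 0%N.
  by move=> h; have /andP[_] := bt i; rewrite L0 // leqn0 => /eqP.
have s0 i : (r <= i)%N -> s i = 0%N by move=> h; have := st i; rewrite t0 // leqn0 => /eqP.
rewrite bigA_distr_bigA /=.
pose good (K : {set C}) := [&& `[< ideal K >], S \subset K & K \subset T].
pose term (K : {set C}) := @kernel_shape la mu E x p be S K * @kernel_shape la mu E y q be K T.
transitivity (\sum_(K | good K) term K).
  rewrite [RHS]big_mkcond; apply: eq_bigr => K _; case: ifP => // hg.
  have [h|h] := boolP (S \subset K); last by rewrite (kernel_not_sub x p be h) mul0r.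
  have [h'|h'] := boolP (K \subset T); last by rewrite (kernel_not_sub y q be h') mulr0.
  rewrite (kernel_not_ideal y q be iT) ?mulr0 // => iK.
  by case/and3P: hg; split=> //; apply/asboolP.
have pL (K : {set C}) i : is_profile la mu (profile K) -> (profile K i <= w)%N.
  by move=> [/(_ i) /andP[_ h] _]; apply: leq_trans h (L_le hla i).
pose enc (K : {set C}) : {ffun 'I_r.+1 -> 'I_w.+1} :=
  [ffun i : 'I_r.+1 => inord (profile K i)].
have pK (K : {set C}) i : ideal K -> extend (enc K) i = profile K i.
  move=> hK; have pp := profileP hla hmu hsub hK.
  case: (ltnP i r.+1) => hi.
    by rewrite -[i]/(nat_of_ord (Ordinal hi)) extendE ffunE inordK // ltnS pL.
  rewrite extend_out //; have [/(_ i) /andP[_]] := pp.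
  by rewrite (L0 (ltnW hi)) leqn0 => /eqP.
rewrite (reindex_onto (fun k => cells_below la mu (extend k)) enc) /=; last first.
  move=> K /and3P[/asboolP hK _ _].
  rewrite -[RHS](cells_below_profile hla hmu hK).
  by apply/setP => c; rewrite !inE pK.
rewrite big_mkcond; apply: eq_bigr => k _; set v := extend k.
pose ok := [forall i : 'I_r.+1, [&& s i <= v i, v i <= t i, t i.+1 <= v i &
   (if i : nat is i'.+1 then v i <= s i' else true)]%N].
have v0 i : (r < i)%N -> v i = 0%N by apply: extend_out.
have [/forallP h|] := boolP ok.
  have sv i : (s i <= v i)%N.
    case: (ltnP i r.+1) => hi; first by have /and4P[] := h (Ordinal hi).
    by rewrite s0 // ltnW.
  have vt i : (v i <= t i)%N.
    case: (ltnP i r.+1) => hi; first by have /and4P[] := h (Ordinal hi).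
    by rewrite v0.
  have tv i : (t i.+1 <= v i)%N.
    case: (ltnP i r.+1) => hi; first by have /and4P[] := h (Ordinal hi).
    by rewrite t0 // ltnW // ltnW.
  have vs i : (v i.+1 <= s i)%N.
    case: (ltnP i.+1 r.+1) => hi; first by have /and4P[] := h (Ordinal hi).
    by rewrite v0.
  have pv : is_profile la mu v.
    split=> i; last exact: leq_trans (vs i) (sv i).
    have /andP[h1 _] := bs i; have /andP[_ h2] := bt i.
    by rewrite (leq_trans h1 (sv i)) (leq_trans (vt i) h2).
  have gv : good (cells_below la mu v).
    apply/and3P; split; first by apply/asboolP/ideal_cells_below.
      rewrite -(cells_below_profile hla hmu iS); exact: cells_below_mono.
    rewrite -(cells_below_profile hla hmu iT); exact: cells_below_mono.
  rewrite gv /=; case: eqP => [_|[]]; last first.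
    apply/ffunP => i; rewrite ffunE profile_cells_below // /v extendE.
    by apply: val_inj; rewrite /= inordK.
  rewrite /term -{1}(cells_below_profile hla hmu iS) -{1}(cells_below_profile hla hmu iT).
  rewrite !kernel_profile //.
  (* [A] at row i is the corner weight of row i - 1 in the first step, hence the shift by one in the
     product below. *)
  pose A i n : E := if i is i'.+1 then
     if (M i' < s i')%N && (n < s i')%N then corner_weight x p be i' (s i').-1 else 1 else 1.
  pose B i n : E := (\prod_(s i <= j < n) (x * p j)) * (\prod_(n <= j < t i) (y * q j)) *
    (if (M i < n)%N && (t i.+1 < n)%N then corner_weight y q be i n.-1 else 1).
  have -> : \prod_(i < r.+1) row_weight M s t be x p y q i (k i) =
      (\prod_(i < r.+1) B i (v i)) * \prod_(i < r.+1) A i (v i).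
    rewrite -big_split; apply: eq_bigr => i _; rewrite /row_weight -extendE -/v.
    have := h i; rewrite -/(v i) => ->.
    by [].
  rewrite big_ord_recr [X in _ * _ * X]big_ord_recl /= mul1r.
  have -> : B r (v r) = 1.
    have vr : v r = 0%N by have := vt r; rewrite t0 // leqn0 => /eqP.
    by rewrite /B vr t0 // s0 // !big_geq // !mul1r /=.
  rewrite mulr1 -!big_split; apply: eq_bigr => i _ /=.
  rewrite /row_kernel -/s -/t.
  have -> : (s i < v i.+1)%N = false by rewrite ltnNge vs.
  have -> : (v i < t i.+1)%N = false by rewrite ltnNge tv.
  rewrite !andbF /A /B /bump /= add1n.
  move: (\prod_(_ <= _ < _) _) (\prod_(_ <= _ < _) _) => P Q.
  by move: (if _ then _ else _) (if _ then _ else _) => a b; ring.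
rewrite negb_forall => /existsP[i hi].
have -> : \prod_(i < r.+1) row_weight M s t be x p y q i (k i) = 0.
  rewrite (bigD1 i) //= /row_weight -extendE -/v (negbTE hi) mul0r //.
case: ifP => // /andP[/and3P[/asboolP gI gS gT] /eqP gk].
have vE j : v j = profile (cells_below la mu v) j by rewrite -pK // gk.
have pv : is_profile la mu v.
  by have := profileP hla hmu hsub gI; rewrite (_ : profile _ = v) //; apply: funext => j; rewrite vE.
have sv j : (s j <= v j)%N by rewrite vE; apply: profile_mono.
have vt j : (v j <= t j)%N by rewrite vE; apply: profile_mono.
have tpos j : (0 < t j)%N -> (j < r)%N.
  by move=> h; rewrite ltnNge; apply/negP => /t0 e; rewrite e in h.
rewrite /term -{1}(cells_below_profile hla hmu iS) -{1}(cells_below_profile hla hmu iT).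
rewrite !kernel_profile // -/s -/t.
(* Outside the bounds a new cell is filled above a filled one: in the second step if n_i < t_(i+1),
   in the first if n_i > s_(i-1). *)
move: hi; rewrite sv vt /= negb_and => /orP[].
  rewrite -ltnNge => h1.
  have h2 : (v i < t i)%N by apply: leq_trans h1 (dt i).
  have ir := tpos _ (leq_ltn_trans (leq0n _) h2).
  by rewrite [X in _ * X](bigD1 (Ordinal ir)) //= [X in _ * (X * _)]/row_kernel h2 h1 mul0r mulr0.
case ei : (i : nat) => [|i'] //; rewrite -ltnNge => h1.
have [_ dv] := pv.
have h2 : (s i' < v i')%N by apply: leq_trans h1 (dv _).
have ir : (i' < r)%N by apply: tpos; apply: leq_trans (vt i'); apply: leq_ltn_trans h2.
by rewrite [X in X * _](bigD1 (Ordinal ir)) //= [X in (X * _) * _]/row_kernel h2 h1 !mul0r.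
Qed.

Lemma kernel_comm (al : nat -> E) (x : E) p y q be S T :
  (forall j, p j * (1 - al j * x) = 1) -> (forall j, q j * (1 - al j * y) = 1) ->
  ideal T ->
  \sum_(K : {set C}) @kernel_shape la mu E x p be S K * @kernel_shape la mu E y q be K T =
  \sum_(K : {set C}) @kernel_shape la mu E y q be S K * @kernel_shape la mu E x p be K T.
Proof.
move=> pE qE iT.
have [iS|nS] := pselect (ideal S); last first.
  have z (x' y' : E) p' q' : \sum_(K : {set C}) @kernel_shape la mu E x' p' be S K *
      @kernel_shape la mu E y' q' be K T = 0.
    rewrite big1 // => K _; have [iK|nK] := pselect (ideal K).
      by rewrite (kernel_not_ideal x' p' be iK nS) mul0r.
    by rewrite (kernel_not_ideal y' q' be iT nK) mulr0.
  by rewrite !z.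
have [sST|nST] := boolP (S \subset T); last first.
  have z (x' y' : E) p' q' : \sum_(K : {set C}) @kernel_shape la mu E x' p' be S K *
      @kernel_shape la mu E y' q' be K T = 0.
    rewrite big1 // => K _; case: (boolP (S \subset K)) => [h|h].
      rewrite (kernel_not_sub y' q' be (_ : ~~ (K \subset T))) ?mulr0 //.
      by apply: contraNN nST; apply: subset_trans.
    by rewrite (kernel_not_sub x' p' be h) mul0r.
  by rewrite !z.
rewrite !two_letter_kernel //.
have [bs _] := profileP hla hmu hsub iS; have [bt _] := profileP hla hmu hsub iT.
apply: (@prod_row_weight_sym _ _ _ _ _ _ al) => // [i|||i].
- by have /andP[] := bs i.
- by have /andP[_] := bs r; rewrite L0 // leqn0 => /eqP.
- by have /andP[_] := bt r.+1; rewrite L0 // leqn0 => /eqP.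
by have /andP[_ h] := bt i; apply: leq_trans h (L_le hla i).
Qed.
End TwoStep.

Lemma kernel_map (C : finType) (Hr Vr : rel C) (E F : comNzRingType) (f : E -> F)
    (X G : C -> E) (S T : {set C}) :
  f 0 = 0 -> f 1 = 1 -> {morph f : u v / u * v} ->
  f (kernel Hr Vr X G S T) = kernel Hr Vr (fun c => f (X c)) (fun c => f (G c)) S T.
Proof.
move=> f0 f1 fM; rewrite /kernel (big_morph f fM f1); apply: eq_bigr => c _.
rewrite /local_weight; case: (c \in S); case: (c \in T); rewrite ?f0 ?f1 //.
  by case: blocked.
by case: blocked.
Qed.

Lemma eq_kernel (C : finType) (Hr Vr : rel C) (E : comNzRingType)
    (X G X' G' : C -> E) S T : X =1 X' -> G =1 G' ->
  kernel Hr Vr X G S T = kernel Hr Vr X' G' S T.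
Proof. by move=> hX hG; apply: eq_bigr => c _; rewrite /local_weight hX hG. Qed.

Section SeriesMorphisms.
Variable R : comNzRingType.

Lemma sconst_mul (u : R) (f : series R) n : (sconst u * f) n = u * f n.
Proof.
rewrite seriesM big_ord_recl big1 ?addr0 ?subn0 // => i _; exact: mul0r.
Qed.

Lemma sconstD : {morph (@sconst R) : u v / u + v}.
Proof. by move=> u v; apply: funext => -[|n] //; rewrite seriesD addr0. Qed.

Lemma sconstM : {morph (@sconst R) : u v / u * v}.
Proof. by move=> u v; apply: funext => -[|n]; rewrite sconst_mul //= mulr0. Qed.

Lemma sconst0 : sconst (0 : R) = 0. Proof. by apply: funext => -[]. Qed.
Lemma sconst1 : sconst (1 : R) = 1. Proof. by apply: funext => -[]. Qed.
End SeriesMorphisms.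

(** * Commutation through series in two variables *)

Section Lift.
Variable R : comNzRingType.

(** With x the inner and y the outer variable of R[[x]][[y]], [sconst] reads a series in x and
    [outer] reads it in y. *)
Definition outer (f : series R) : series (series R) := smap (@sconst R) f.

Lemma outerM : {morph outer : f g / f * g}.
Proof.
move=> f g; apply: funext => n; rewrite /outer /smap !seriesM (morphD_sum (@sconstD R)).
by apply: eq_bigr => i _; rewrite sconstM.
Qed.

Lemma outerD : {morph outer : f g / f + g}.
Proof. by move=> f g; apply: funext => n; rewrite /outer /smap !seriesD sconstD. Qed.

Lemma outer0 : outer 0 = 0.
Proof. by apply: funext => n; rewrite /outer /smap !series0 sconst0. Qed.

Lemma outer1 : outer 1 = 1.
Proof.
apply: funext => n; rewrite /outer /smap !series1; case: n => [|n] /=.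
  exact: sconst1.
exact: sconst0.
Qed.

Lemma outer_sconst u : outer (sconst u) = sconst (sconst u).
Proof. by apply: funext => -[|n] //; rewrite /outer /smap /= sconst0. Qed.

Lemma outer_svar : outer (svar R) = svar (series R).
Proof.
apply: funext => n; rewrite /outer /smap /svar; case: (_ == _); rewrite /=.
  exact: sconst1.
exact: sconst0.
Qed.

Lemma outer_geom u : outer (geom u) = geom (sconst u).
Proof.
apply: funext => n; rewrite /outer /smap /geom; elim: n => [|n IH].
  by rewrite !expr0 sconst1.
by rewrite !exprS sconstM IH.
Qed.

Lemma coef_inner_outer f g m n : (sconst f * outer g) m n = f n * g m.
Proof. by rewrite sconst_mul mulrC sconst_mul mulrC. Qed.
End Lift.

Section Commute.
Variables la mu : seq nat.
Hypotheses (hla : is_partition la) (hmu : is_partition mu) (hsub : partition_sub mu la).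
Local Notation C := (skew_cell la mu).
Variables (R : comNzRingType) (al be : nat -> R).

Let a (c : C) := al (cell_col c).
Let b (c : C) := be (cell_row c).
Local Notation Hr := (@right_of la mu).
Local Notation Vr := (@below la mu).
Let ker := kernel Hr Vr (new_weight a) (old_weight a b).

Lemma kernel_coef_comm (S T : {set C}) n m : ideal T ->
  \sum_(K : {set C}) ker S K n * ker K T m = \sum_(K : {set C}) ker S K m * ker K T n.
Proof.
move=> iT.
pose E := series (series R).
pose x : E := sconst (svar R); pose y : E := svar (series R).
pose p j : E := sconst (geom (al j)); pose q j : E := geom (sconst (al j)).
pose bb i : E := sconst (sconst (be i)); pose aa i : E := sconst (sconst (al i)).
have ow c : old_weight a b c = (1 + sconst (b c) * svar R) * geom (a c).
  by rewrite old_weightE sconstN mulNr opprK.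
have e1 U V : sconst (ker U V) = @kernel_shape la mu E x p bb U V.
  rewrite /ker kernel_map; [|exact: sconst0|exact: sconst1|exact: sconstM].
  apply: eq_kernel => c; first by rewrite new_weightE sconstM.
  by rewrite ow sconstM sconstD sconst1 sconstM.
have e2 U V : outer (ker U V) = @kernel_shape la mu E y q bb U V.
  rewrite /ker kernel_map; [|exact: outer0|exact: outer1|exact: outerM].
  apply: eq_kernel => c; first by rewrite new_weightE outerM outer_svar outer_geom.
  by rewrite ow outerM outerD outer1 outerM outer_svar outer_geom outer_sconst.
have pE j : p j * (1 - aa j * x) = 1.
  rewrite /p /aa /x -sconstM -sconst1 -sconstN -sconstD -sconstM mulrC geomV //.
have qE j : q j * (1 - aa j * y) = 1 by rewrite mulrC geomV.
have h := @kernel_comm la mu hla hmu hsub E aa x p y q bb S T pE qE iT.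
have hs (F : {set C} -> E) : (\sum_K F K) m n = \sum_K (F K m n).
  by rewrite (series_sum (V := series R)) (series_sum (V := R)).
transitivity ((\sum_(K : {set C}) @kernel_shape la mu E x p bb S K *
    @kernel_shape la mu E y q bb K T) m n).
  by rewrite hs; apply: eq_bigr => K _; rewrite -e1 -e2 coef_inner_outer.
rewrite h hs; apply: eq_bigr => K _.
by rewrite -e1 -e2 mulrC coef_inner_outer mulrC.
Qed.

Let U := letter_op Hr Vr a b.
(** [kernel_coef_comm] asks for an ideal as target; the indicator of [setT] and all its images are
    supported on ideals. *)
Let ideal_supp (w : {ffun {set C} -> R}) := forall S, ~ ideal S -> w S = 0.

Lemma ideal_supp_op n w : ideal_supp w -> ideal_supp (U n w).
Proof.
move=> hw S nS; rewrite ffunE big1 // => T _.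
have [iT|nT] := pselect (ideal T); last by rewrite hw // mulr0.
have -> : kernel Hr Vr (new_weight a) (old_weight a b) S T = 0; last by rewrite mul0r.
rewrite -[RHS](@kernel_not_ideal la mu (series R) (svar R) (fun j => geom (al j))
   (fun i => sconst (be i)) S T iT nS).
apply: eq_kernel => c; first exact: new_weightE.
by rewrite old_weightE sconstN mulNr opprK.
Qed.

Lemma letter_op_comm n m w : ideal_supp w -> U n (U m w) = U m (U n w).
Proof.
move=> hw; apply/ffunP => S; rewrite !ffunE.
have e i j : \sum_(K : {set C}) ker S K i * U j w K =
    \sum_(T : {set C}) (\sum_(K : {set C}) ker S K i * ker K T j) * w T.
  under [RHS]eq_bigr do rewrite mulr_suml.
  rewrite [RHS]exchange_big; apply: eq_bigr => K _.
  rewrite ffunE mulr_sumr; apply: eq_bigr => T _; by rewrite mulrA.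
rewrite -!/(ker _ _) !e; apply: eq_bigr => T _.
have [iT|nT] := pselect (ideal T); last by rewrite hw // !mulr0.
by rewrite kernel_coef_comm.
Qed.

Lemma tableau_sum_symmetric : symmetric_fps (tableau_sum Hr Vr a b).
Proof.
move=> s1 i j s2; rewrite !tableau_sumE -/U /run !foldr_cat.
set v := [ffun S => _]; suff -> : foldr U v [:: i, j & s2] = foldr U v [:: j, i & s2] by [].
apply: letter_op_comm; elim: s2 => [|n s2 IH] /=; last exact: ideal_supp_op.
move=> S nS; rewrite ffunE; case: eqP => // e; case: nS => c c' _ _.
by rewrite e inE.
Qed.
End Commute.

Lemma grid_corner la mu (N : {set skew_cell la mu}) : N != set0 ->
  exists2 c, c \in N & (forall c', right_of c c' -> c' \notin N) /\
  (forall d, below d c -> d \notin N /\ forall c', right_of d c' -> c' \notin N).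
Proof.
move=> /set0Pn [c0 hc0]; set w := head 0%N la.
(* Orders cells by row, then from right to left; the factor w + 1 exceeds every w - col, so the row
   decides first. The minimum is the rightmost cell of the top row of N. *)
pose f (c : skew_cell la mu) := (cell_row c * w.+1 + (w - cell_col c))%N.
have [c hc hmin] := arg_minnP f hc0; exists c => //.
have hw (d : skew_cell la mu) : (cell_col d < w)%N by apply: (ltn_ord (val d).2).
have lt d : (f d < f c)%N -> d \notin N.
  by move=> h; apply/negP => /hmin; rewrite leqNgt h.
split=> [c' /andP[/eqP e1 /eqP e2]|d /andP[/eqP e1 /eqP e2]].
  by apply: lt; rewrite /f e1 e2; have := hw c'; lia.
split=> [|c' /andP[/eqP e3 /eqP e4]]; apply: lt; rewrite /f e1 ?e3; nia.
Qed.

(** * Transposition *)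

Section Reindex.
Variables (C C' : finType) (f : C -> C') (g : C' -> C).
Hypotheses (fK : cancel f g) (gK : cancel g f).
Variables (H V : rel C') (R : comNzRingType) (a b : C' -> R).

Lemma forall_bij (P : pred C') : [forall c, P c] = [forall c, P (f c)].
Proof. by apply/forallP/forallP => h c //; rewrite -(gK c). Qed.

Lemma tableau_bij T : tableau H V (T \o g) =
  tableau (fun c d => H (f c) (f d)) (fun c d => V (f c) (f d)) T.
Proof.
rewrite /tableau; congr [&& _, _ & _]; rewrite forall_bij; apply: eq_forallb => c.
- by rewrite /= fK.
- by rewrite forall_bij; apply: eq_forallb => d; rewrite /= !fK.
- by rewrite forall_bij; apply: eq_forallb => d; rewrite /= !fK.
Qed.

Lemma tableau_sum_bij : tableau_sum H V a b =
  tableau_sum (fun c d => H (f c) (f d)) (fun c d => V (f c) (f d)) (a \o f) (b \o f).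
Proof.
apply: funext => m; rewrite /tableau_sum.
pose h (B : filling C m) : filling C' m := [ffun c' => B (g c')].
pose h' (B : filling C' m) : filling C m := [ffun c => B (f c)].
have hE B : letters (h B) = letters B \o g.
  by apply: funext => c'; rewrite /letters ffunE.
have bf : bijective f by exists g.
rewrite (reindex_onto h h') => [|B _]; last by apply/ffunP => c'; rewrite !ffunE gK.
apply: eq_big => [B|B _]; rewrite hE.
  have -> : h' (h B) = B by apply/ffunP => c; rewrite !ffunE fK.
  rewrite eqxx andbT tableau_bij; congr (_ && (_ == _)).
  rewrite /tableau_xweight (reindex f) /=; last exact: onW_bij.
  by apply: eq_bigr => c _; rewrite fK.
rewrite /tableau_weight (reindex f) /=; last exact: onW_bij.
by apply: eq_bigr => c _; rewrite fK.
Qed.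
End Reindex.

Section Transpose.
Variable la : seq nat.
Hypothesis hla : is_partition la.

(** The equivalence from which the facts on transposes below are deduced. *)
Lemma nth_transpose i j : (i < nth 0 (transpose la) j)%N = (j < nth 0 la i)%N.
Proof.
have hd : (nth 0 la i <= head 0 la)%N by rewrite -nth0; apply: part_anti.
case: (ltnP j (head 0%N la)) => hj; last first.
  rewrite nth_default ?ltn0 ?size_map ?size_iota //.
  by apply/esym/negbTE; rewrite -leqNgt (leq_trans hd).
rewrite (nth_map 0%N) ?size_iota // nth_iota // add0n {hd hj}.
have /andP[] := hla; move=> + _; elim: (la) i => [|p s IH] i; first by rewrite nth_nil !ltn0.
move=> hs; have ss := path_sorted hs.
have hp : all (geq p) s.
  move: hs; rewrite /= path_sortedE => [/andP[]//|x y z h1 h2]; exact: leq_trans h2 h1.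
rewrite /=; case: (ltnP j p) => hj.
  by case: i => [|i]; rewrite add1n // ltnS IH.
have -> : count (fun k => j < k)%N s = 0%N.
  apply/eqP; rewrite eqn0Ngt -has_count -all_predC.
  by apply: sub_all hp => k hk /=; rewrite -leqNgt (leq_trans hk).
apply/esym/negbTE; rewrite -leqNgt; case: i => [//|i] /=.
case: (ltnP i (size s)) => hi; last by rewrite nth_default.
exact: leq_trans (allP hp _ (mem_nth 0%N hi)) hj.
Qed.
End Transpose.

Lemma is_partition_transpose la : is_partition la -> is_partition (transpose la).
Proof.
move=> hla; apply/andP; split.
  apply/(sortedP 0%N) => i _; rewrite /geq /= leqNgt nth_transpose // -leqNgt.
  by apply: leqW; rewrite leqNgt -nth_transpose // ltnn.
apply/negP => /mapP[j]; rewrite mem_iota add0n => /andP[_ hj] e.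
have := nth_transpose hla 0 j; rewrite nth0 hj (nth_map 0%N) ?size_iota // nth_iota // add0n -e.
by rewrite ltnn.
Qed.

Lemma partition_sub_transpose la mu : is_partition la -> is_partition mu ->
  partition_sub mu la -> partition_sub (transpose mu) (transpose la).
Proof.
move=> hla hmu hsub j; rewrite leqNgt nth_transpose // -leqNgt.
apply: leq_trans (hsub _) _.
by rewrite leqNgt -nth_transpose // ltnn.
Qed.

Lemma in_skew_transpose la mu i j : is_partition la -> is_partition mu ->
  in_skew (transpose la) (transpose mu) j i = in_skew la mu i j.
Proof. by move=> hla hmu; rewrite /in_skew leqNgt !nth_transpose // -leqNgt. Qed.

Lemma transpose_cells la mu : is_partition la -> is_partition mu ->
  exists (f : skew_cell la mu -> skew_cell (transpose la) (transpose mu)) g,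
  [/\ cancel f g, cancel g f, (forall c, cell_row (f c) = cell_col c) &
      (forall c, cell_col (f c) = cell_row c)].
Proof.
move=> hla hmu; have hla' := is_partition_transpose hla.
have /choice [f hf] : forall c : skew_cell la mu, exists d : skew_cell (transpose la) (transpose mu),
    cell_row d = cell_col c /\ cell_col d = cell_row c.
  move=> c; apply: cellP => //.
  by have := cell_bounds c; rewrite -!/(in_skew _ _ _ _) in_skew_transpose.
have /choice [g hg] : forall d : skew_cell (transpose la) (transpose mu), exists c : skew_cell la mu,
    cell_row c = cell_col d /\ cell_col c = cell_row d.
  move=> d; apply: cellP => //.
  by have := cell_bounds d; rewrite -!/(in_skew _ _ _ _) in_skew_transpose.
exists f, g; split=> [c|d|c|c]; try by have [] := hf c.
- have [e1 e2] := hf c; have [e3 e4] := hg (f c).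
  by apply: cell_inj; rewrite ?e3 ?e4 ?e1 ?e2.
have [e1 e2] := hg d; have [e3 e4] := hf (g d).
by apply: cell_inj; rewrite ?e3 ?e4 ?e1 ?e2.
Qed.

Lemma GrothE la mu (R : comNzRingType) (al be : nat -> R) :
  Groth la mu al be = tableau_sum (@right_of la mu) (@below la mu)
    (fun c => al (cell_col c)) (fun c => - be (cell_row c)).
Proof. by []. Qed.

(** * The pair formed by the two series, and omega *)

Section Main.
Variables (R : comNzRingType) (la mu : seq nat) (al be : nat -> R).
Hypotheses (hla : is_partition la) (hmu : is_partition mu) (hsub : partition_sub mu la).

Local Notation G := (Groth la mu al be).
Local Notation G' :=
  (Groth (transpose la) (transpose mu) (fun i => - be i) (fun i => - al i)).

Lemma Groth_symmetric : symmetric_fps G.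
Proof. exact: (@tableau_sum_symmetric la mu hla hmu hsub R al (fun i => - be i)). Qed.

(** Pulled back to the cells of the original shape, transposition exchanges the neighbour relations
    and the weights, alpha being negated twice: this is the second family of [letter_op_dual]. *)
Lemma Groth_transposeE : G' = tableau_sum (@below la mu) (@right_of la mu)
    (fun c => - be (cell_row c)) (fun c => al (cell_col c)).
Proof.
have [f [g [fK gK fr fc]]] := transpose_cells hla hmu.
rewrite GrothE (tableau_sum_bij fK gK).
have -> : (fun c d => right_of (f c) (f d)) = @below la mu.
  by apply: funext => c; apply: funext => d; rewrite /right_of /below !fr !fc andbC.
have -> : (fun c d => below (f c) (f d)) = @right_of la mu.
  by apply: funext => c; apply: funext => d; rewrite /right_of /below !fr !fc andbC.
rewrite [X in tableau_sum _ _ X _](_ : _ = fun c => - be (cell_row c)); last first.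
  by apply: funext => c; rewrite /= fc.
rewrite [X in tableau_sum _ _ _ X](_ : _ = fun c => al (cell_col c)) //.
by apply: funext => c; rewrite /= fr opprK.
Qed.

Lemma Groth_omega_pair : omega_pair G G'.
Proof.
have d := letter_op_dual (fun c => al (cell_col c)) (fun c => - be (cell_row c))
  (@grid_corner la mu).
apply: (OmegaPair (phi := fun v : {ffun _ -> R} => v set0) d) => [u v|s|s].
- by rewrite ffunE.
- by rewrite GrothE tableau_sumE.
by rewrite Groth_transposeE tableau_sumE.
Qed.
End Main.

Lemma symmetric_homog (R : comNzRingType) d (F : fps R) :
  symmetric_fps F -> symmetric_fps (homog d F).
Proof.
move=> h s1 a b s2; rewrite /homog !mdeg_mon !sumn_cat /= (addnCA a).
by case: ifP => // _; apply: h.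
Qed.

Theorem omega_Groth (R : comNzRingType) (la mu : seq nat) (al be : nat -> R)
    (hla : is_partition la) (hmu : is_partition mu) (hsub : partition_sub mu la) :
  omega (Groth la mu al be) =
  Groth (transpose la) (transpose mu) (fun i => - be i) (fun i => - al i).
Proof.
set G := Groth la mu al be; set G' := Groth _ _ _ _.
have sG' : symmetric_fps G'.
  apply: Groth_symmetric; first exact: is_partition_transpose.
    exact: is_partition_transpose.
  exact: partition_sub_transpose.
have pG : omega_pair G G' := Groth_omega_pair _ _ hla hmu.
apply: funext => m; rewrite /omega; set d := mdeg m.
have hom : homogeneous_fps d (homog d G') by move=> m'; rewrite /homog; case: eqP.
(* H is so far an unknown preimage of the degree d part of the transposed series. *)
have [H gH] := symmetric_omega_graph hom (@symmetric_homog _ d _ sG').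
have pH := omega_graph_pair gH.
have eH : H = homog d G.
  apply: funext => m'; rewrite /homog; case: eqP => e.
    apply: (omega_pair_bwd pH pG) e => m'' e.
    by rewrite /homog e eqxx.
  (* In every other degree the image is 0, hence so is H. *)
  apply: (omega_pair_bwd pH (omega_pair0 R) (d := mdeg m')) => // m'' e'.
  by rewrite /homog e'; case: eqP.
(* The graph is inhabited at [homog d G], so [epsilon] returns an image; uniqueness in degree d then
   identifies it. *)
have gO : omega_graph (homog d G) (omega_bounded (homog d G)).
  by apply: epsilon_spec; exists (homog d G'); rewrite -eH.
apply: (omega_pair_fwd (omega_graph_pair gO) pG (d := d)) => // m' e.
by rewrite /homog e eqxx.
Qed.

Theorem theorem8p6 (la mu : seq nat)
    (hla : is_partition la) (hmu : is_partition mu)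
    (hsub : partition_sub mu la) :
  omega (Groth la mu alpha beta) =
  Groth (transpose la) (transpose mu) (fun i => - beta i) (fun i => - alpha i).
Proof. exact: omega_Groth. Qed.
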